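(* Let $S_\xi\subset\mathbb S^3$ be a rotational surface generated by a unit-speed spherical curve $\xi=(x,y,z)$ with $z$ nowhere zero, with principal curvatures $k_{\mathrm m}$ (along meridians) and $k_{\mathrm p}$ (along parallels). Then $S_\xi$ satisfies the cubic Weingarten relation $k_{\mathrm m}=\mu\,k_{\mathrm p}^3$ for some constant $\mu\in\mathbb R$ if and only if, up to a translation along $\xi_0$, $S_\xi$ is (an open part of) one of the following surfaces: (i) the totally geodesic equatorial sphere; (ii) a totally umbilical sphere; (iii) a standard torus; (iv) a spherical moon; (v) a non-degenerate quadric surface of revolution.
   Context: $\mathbb S^2\subset\mathbb R^3$ and $\mathbb S^3\subset\mathbb R^4$ are the unit spheres; $\mathbb S^2$ is identified with the totally geodesic sphere $\{x_4=0\}$ of $\mathbb S^3$. The equator $\xi_0$ of $\mathbb S^2$ is the great circle $z=0$; it is the axis of revolution. Rotational surfaces. Let $\xi=(x,y,z):I\to\mathbb S^2$ be a smooth curve parametrized by arc length $s$ on an interval $I\subseteq\mathbb R$. The rotational surface generated by $\xi$ is $S_\xi$: $X(s,t)=(x(s),y(s),z(s)\cos t,z(s)\sin t)$. Where $z\ne0$ its principal curvatures are $k_{\mathrm m}=\kappa$ and $k_{\mathrm p}=(\dot x y-x\dot y)/z$, where $\kappa=\det(\xi,\dot\xi,\ddot\xi)$ is the geodesic curvature of $\xi$ in $\mathbb S^2$. For a curve (or one-dimensional subset) $\mathcal C\subset\mathbb S^2$, $S_{\mathcal C}$ denotes the surface obtained in the same way by rotating $\mathcal C$. A translation along $\xi_0$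 is a rotation of the $x_1x_2$-plane fixing the $x_3x_4$-plane pointwise (equivalently, a rotation of $\xi$ around the $z$-axis). The listed surfaces: - totally geodesic equatorial sphere: $\mathbb S^3\cap\{x_2=0\}$, generated by the great circle $\{y=0\}$; - totally umbilical spheres: $\mathbb S^3\cap\{x_2=\tanh\delta\}$, $\delta\ge0$, generated by the small circles $\{y=\tanh\delta\}$; - standard tori: $\{x_3^2+x_4^2=\sin^2\varphi_0\}\cap\mathbb S^3$, $\varphi_0\in(0,\pi/2)$, generated by the parallels $\{z=\sin\varphi_0\}$; - spherical moons: generated by the great circles $\mu_\theta=\{\sin\theta\,y=\cos\theta\,z\}$, $\theta\in(0,\pi)$, $\theta\neq\pi/2$; - non-degenerate quadric surfaces of revolution: the surfaces generated by the spherical conics $$\mathcal{CV}_{AB}=\mathbb S^2\cap\Big\{\tfrac{x^2}{A^2}+\tfrac{y^2}{B^2}=1\Big\},\qquad \mathcal{CH}_{CD}=\mathbb S^2\cap\Big\{\tfrac{x^2}{C^2}+\tfrac{z^2}{D^2}=1\Big\}\qquad(A,B,C,D>0)$$ in the following cases: (I) one-piece spherical hyperboloids of revolution: $S_{\mathcal{CH}_{CD}}$ with $D<1<C$ (equivalently $S_{\mathcal{CV}_{AB}}$ with $B<A<1$); (IIa) two-piece spherical hyperboloids of revolution: $S_{\mathcal{CV}_{AB}}$ with $B<1<A$ (equivalently $S_{\mathcal{CH}_{CD}}$ with $D<C<1$); (IIb) prolate spherical ellipsoids of revolution: $S_{\mathcal{CV}_{AB}}$ with $A<1<B$; (III) oblate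 spherical ellipsoids of revolution: $S_{\mathcal{CH}_{CD}}$ with $C<1<D$. Spherical paraboloids of revolution are special cases of (I) and (IIa). *)

(* Defs.v *)
From Stdlib Require Export Reals.
From Coquelicot Require Export Coquelicot.
Open Scope R_scope.

Notation R3 := (R * R * R)%type.
Notation R4 := (R * R * R * R)%type.

Definition x1 (p : R4) : R := let '(a, _, _, _) := p in a.
Definition x2 (p : R4) : R := let '(_, b, _, _) := p in b.
Definition x3 (p : R4) : R := let '(_, _, c, _) := p in c.
Definition x4 (p : R4) : R := let '(_, _, _, d) := p in d.

Definition dot (p q : R4) : R :=
  x1 p * x1 q + x2 p * x2 q + x3 p * x3 q + x4 p * x4 q.

Definition sphere2 (p : R3) : Prop :=
  let '(x, y, z) := p in x ^ 2 + y ^ 2 + z ^ 2 = 1.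

Definition sphere3 (p : R4) : Prop := dot p p = 1.

Definition nondegenerate_interval (I : R -> Prop) : Prop :=
  (forall a b c, I a -> I b -> a <= c <= b -> I c) /\
  (exists a b, I a /\ I b /\ a < b).

(* The interval may contain its endpoints.  As usual for non-open sets,
   smoothness means that the function is smooth in a neighbourhood of every
   point of [I]; the values of [f] outside [I] are otherwise irrelevant. *)
Definition smooth_on (I : R -> Prop) (f : R -> R) : Prop :=
  forall n s, I s -> locally s (fun u => ex_derive_n f n u).

Definition unit_speed_spherical_curve (I : R -> Prop) (x y z : R -> R) : Prop :=
  smooth_on I x /\ smooth_on I y /\ smooth_on I z /\
  (forall s, I s -> sphere2 (x s, y s, z s)) /\
  (forall s, I s -> Derive x s ^ 2 + Derive y s ^ 2 + Derive z s ^ 2 = 1).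

Definition rotate (p : R3) (t : R) : R4 :=
  let '(x, y, z) := p in (x, y, z * cos t, z * sin t).

Definition rot_param (x y z : R -> R) (s t : R) : R4 :=
  rotate (x s, y s, z s) t.

Definition rot_surface (C : R3 -> Prop) (p : R4) : Prop :=
  exists q t, C q /\ p = rotate q t.

Definition translation (a : R) (p : R4) : R4 :=
  (cos a * x1 p - sin a * x2 p, sin a * x1 p + cos a * x2 p, x3 p, x4 p).

Definition partial_s (X : R -> R -> R4) (s t : R) : R4 :=
  (Derive (fun u => x1 (X u t)) s, Derive (fun u => x2 (X u t)) s,
   Derive (fun u => x3 (X u t)) s, Derive (fun u => x4 (X u t)) s).

Definition partial_t (X : R -> R -> R4) (s t : R) : R4 :=
  (Derive (fun u => x1 (X s u)) t, Derive (fun u => x2 (X s u)) t,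
   Derive (fun u => x3 (X s u)) t, Derive (fun u => x4 (X s u)) t).

(* [N] is tangent to the 3-sphere at [X s t] and normal to the surface. *)
Definition unit_normal (X : R -> R -> R4) (N : R4) (s t : R) : Prop :=
  dot N N = 1 /\ dot N (X s t) = 0 /\
  dot N (partial_s X s t) = 0 /\ dot N (partial_t X s t) = 0.

(* [k] is an eigenvalue, with eigenvector [v1 X_s + v2 X_t], of the shape
   operator of [X] in the 3-sphere relative to [N], i.e. II v = k I v.  Since
   [N] is orthogonal to [X], the second fundamental form in the sphere is
   computed with the second derivatives of [X] in R^4. *)
Definition principal_curvature (X : R -> R -> R4) (N : R4) (s t : R)
    (v : R * R) (k : R) : Prop :=
  let Xs := partial_s X s t in
  let Xt := partial_t X s t in
  let Xss := partial_s (partial_s X) s t in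
  let Xst := partial_t (partial_s X) s t in
  let Xtt := partial_t (partial_t X) s t in
  let '(v1, v2) := v in
  v <> (0, 0) /\
  dot Xss N * v1 + dot Xst N * v2 = k * (dot Xs Xs * v1 + dot Xs Xt * v2) /\
  dot Xst N * v1 + dot Xtt N * v2 = k * (dot Xs Xt * v1 + dot Xt Xt * v2).

(* The immersed surface [X(I x R)] is a part of [S], and its portion over the
   interior of [I] (which is all of it if [I] is open) is relatively open. *)
Definition is_open_part_of (I : R -> Prop) (X : R -> R -> R4)
    (S : R4 -> Prop) : Prop :=
  (forall s t, I s -> S (X s t)) /\
  (exists U : R4 -> Prop, open U /\
     forall p, (exists s t, locally s I /\ p = X s t) <-> (U p /\ S p)).

Definition equatorial_sphere (p : R4) : Prop := sphere3 p /\ x2 p = 0.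

Definition umbilical_sphere (delta : R) (p : R4) : Prop :=
  sphere3 p /\ x2 p = tanh delta.

Definition standard_torus (phi0 : R) (p : R4) : Prop :=
  sphere3 p /\ x3 p ^ 2 + x4 p ^ 2 = sin phi0 ^ 2.

Definition moon_circle (theta : R) (p : R3) : Prop :=
  sphere2 p /\ let '(x, y, z) := p in sin theta * y = cos theta * z.

Definition conicV (A B : R) (p : R3) : Prop :=
  sphere2 p /\ let '(x, y, z) := p in x ^ 2 / A ^ 2 + y ^ 2 / B ^ 2 = 1.

Definition conicH (C D : R) (p : R3) : Prop :=
  sphere2 p /\ let '(x, y, z) := p in x ^ 2 / C ^ 2 + z ^ 2 / D ^ 2 = 1.

Inductive nondegenerate_quadric : (R4 -> Prop) -> Prop :=
| one_piece_hyperboloid (C D : R) :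
    0 < D -> D < 1 -> 1 < C -> nondegenerate_quadric (rot_surface (conicH C D))
| two_piece_hyperboloid (A B : R) :
    0 < B -> B < 1 -> 1 < A -> nondegenerate_quadric (rot_surface (conicV A B))
| prolate_ellipsoid (A B : R) :
    0 < A -> A < 1 -> 1 < B -> nondegenerate_quadric (rot_surface (conicV A B))
| oblate_ellipsoid (C D : R) :
    0 < C -> C < 1 -> 1 < D -> nondegenerate_quadric (rot_surface (conicH C D)).

(* Main.v *)
From Stdlib Require Import Lra Psatz Classical FunctionalExtensionality Ranalysis5.
Require Import Defs.
Open Scope R_scope.

(** Write [xi] for the position, [T] for the velocity and [nu = xi x T] for the
    spherical normal of the curve, and [kappa] for its geodesic curvature.  The
    unit normal of the surface is [e] times [nu] rotated, with a sign [e] that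
    may depend on the point, so that [km = e kappa] and [kp = - e nu_3 / z]
    (lemma [principal_curvatures]).  As the relation is odd, the sign drops out
    and the claim concerns the single equation
    [kappa z^3 = m nu_3^3] ([cubic], with [m = - mu]).

    From the relation to a conic.  Since [nu' = - kappa T], the third component
    satisfies a linear equation [nu_3' = g nu_3], hence vanishes everywhere or
    nowhere.  If it vanishes, then [kappa = 0], the vector [nu] is constant and
    horizontal, and the curve lies on a meridian.  Otherwise pass to the
    gnomonic chart: put [X = x/z], [Y = y/z] for the projected curve and
    [U = nu_1/nu_3], [V = nu_2/nu_3] for its dual curve.  The relation becomes
    [U' = m (nu_3/z^2) Y], [V' = - m (nu_3/z^2) X], while always
    [X' = (nu_3/z^2) V], [Y' = - (nu_3/z^2) U]: a linear system with constant
    coefficients after a change of time.  Its quadratic first integrals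
    [U^2 + m Y^2], [U V - m X Y], [V^2 + m X^2] are the coefficients of a conic
    centred at the origin, and [X U + Y V = -1] says that the curve lies on it
    (lemma [conic_of_cubic]).  A rotation about the [z]-axis diagonalises the
    conic to [a1 x^2 + a2 y^2 = z^2] with [a1 <= a2], and the positions of [a1]
    relative to [-1], [0] and [a2] separate the surfaces of the list
    (lemma [listed_of_diagonal_conic]).

    From a conic to the relation.  On [<Q xi, xi> = 0] with [Q] diagonal the
    vector [Q xi] is orthogonal to [xi] and [T], so [Q xi = l nu].  The
    determinant of [Q] in the frame [(xi, T, nu)] is [- l^2 <Q T, T>], and
    differentiating [<Q xi, T> = 0] gives [<Q T, T> = - l kappa].  Therefore
    [l^3 kappa = det Q]; with [l nu_3 = q3 z] this is the cubic relation
    (lemma [cubic_of_conic]).  All listed surfaces except the equatorial sphere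
    satisfy such an equation with [q3 <> 0].

    Openness.  The curve fills a neighbourhood of each of its interior points
    in the conic: by the intermediate value theorem it takes all values of the
    projection to the tangent line, and that projection is injective on the
    conic near the point, by a determinant argument for pairs of points
    (lemma [open_part]). *)

(** * Constancy on intervals and linear differential equations *)

Lemma ex_derive_continuity_pt (f : R -> R) (s : R) :
  ex_derive f s -> continuity_pt f s.
Proof.
intros df; apply continuity_pt_filterlim.
exact (ex_derive_continuous (V := R_NormedModule) f s df).
Qed.

(** The curve may be defined on a closed interval, and then [f] is constant on one
    side of [s] only; points of [I] close to [s] exist on some side, and they
    determine the derivative. *)
Lemma derive_zero_of_constant (I : R -> Prop) (f : R -> R) (c s l : R) :
  nondegenerate_interval I -> (forall u, I u -> f u = c) ->
  I s -> is_derive f s l -> l = 0.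
Proof.
intros [conv [a [b [Ia [Ib ab]]]]] fc Is df.
destruct (Req_dec l 0) as [l0 | l0]; [exact l0 | exfalso].
apply is_derive_Reals in df.
destruct (df (Rabs l) (Rabs_pos_lt _ l0)) as [d dP].
pose proof (cond_pos d) as d0.
assert (E : exists h, h <> 0 /\ Rabs h < d /\ I (s + h)).
{ destruct (Rle_lt_dec b s) as [bs | sb].
  - exists (- Rmin (d / 2) (s - a)).
    assert (0 < Rmin (d / 2) (s - a)) by (apply Rmin_glb_lt; lra).
    pose proof (Rmin_l (d / 2) (s - a)). pose proof (Rmin_r (d / 2) (s - a)).
    split; [apply Rlt_not_eq;  lra | split; [rewrite Rabs_Ropp, Rabs_pos_eq; lra |]].
    apply (conv a s); [assumption .. | lra].
  - exists (Rmin (d / 2) (b - s)).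
    assert (0 < Rmin (d / 2) (b - s)) by (apply Rmin_glb_lt; lra).
    pose proof (Rmin_l (d / 2) (b - s)). pose proof (Rmin_r (d / 2) (b - s)).
    split; [apply Rgt_not_eq; lra | split; [rewrite Rabs_pos_eq; lra |]].
    apply (conv s b); [assumption .. | lra]. }
destruct E as [h [h0 [hd Ih]]].
specialize (dP h h0 hd).
rewrite (fc _ Ih), (fc _ Is) in dP.
replace ((c - c) / h - l) with (- l) in dP by (field; assumption).
rewrite Rabs_Ropp in dP; lra.
Qed.

Lemma constant_of_derive_zero (I : R -> Prop) (f : R -> R) (a b : R) :
  nondegenerate_interval I -> (forall s, I s -> is_derive f s 0) ->
  I a -> I b -> f a = f b.
Proof.
intros [conv _] df Ia Ib.
destruct (Rtotal_order a b) as [ab | [-> | ba]]; [| reflexivity | symmetry].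
- apply eq_is_derive; [| assumption].
  intros t ht; apply df, (conv a b); assumption.
- apply eq_is_derive; [| assumption].
  intros t ht; apply df, (conv b a); assumption.
Qed.

(** The bound makes [f^2 exp (- 2 M s)] nonincreasing and [f^2 exp (2 M s)]
    nondecreasing, so zeros propagate in both directions. *)
Lemma ode_bound_zero (f f' : R -> R) (M a b : R) :
  a <= b -> (forall s, a <= s <= b -> is_derive f s (f' s)) ->
  (forall s, a <= s <= b -> Rabs (f' s) <= M * Rabs (f s)) ->
  (f a = 0 <-> f b = 0).
Proof.
intros ab df bound.
destruct (Req_dec a b) as [<- | nab]; [tauto |].
assert (key : forall s, a <= s <= b -> Rabs (f s * f' s) <= M * (f s) ^ 2).
{ intros s hs. rewrite Rabs_mult, <- pow2_abs.
  specialize (bound s hs). pose proof (Rabs_pos (f s)). nra. }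
assert (mono : forall sg, sg = 1 \/ sg = - 1 ->
  sg * (f b ^ 2 * exp (- sg * 2 * M * b)) <= sg * (f a ^ 2 * exp (- sg * 2 * M * a))).
{ intros sg hsg.
  destruct (MVT_gen (fun s => sg * (f s ^ 2 * exp (- sg * 2 * M * s))) a b
     (fun s => sg * ((2 * (f s * f' s) - sg * 2 * M * f s ^ 2) * exp (- sg * 2 * M * s))))
     as [c [hc Ec]].
  - rewrite Rmin_left, Rmax_right by lra. intros s hs.
    assert (D := df s ltac:(lra)). auto_derive.
    + exists (f' s); assumption.
    + rewrite (is_derive_unique (fun x : R => f x) _ _ D). ring.
  - rewrite Rmin_left, Rmax_right by lra. intros s hs.
    apply ex_derive_continuity_pt.
    assert (D := df s ltac:(lra)). auto_derive. exists (f' s); assumption.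
  - rewrite Rmin_left, Rmax_right in hc by lra.
    cut (0 <= - (sg * ((2 * (f c * f' c) - sg * 2 * M * f c ^ 2) *
           exp (- sg * 2 * M * c)))); [intros; nra |].
    specialize (key c hc). apply Rabs_le_between in key.
    pose proof (exp_pos (- sg * 2 * M * c)).
    replace (- _) with ((- sg * (2 * (f c * f' c)) + sg ^ 2 * 2 * M * f c ^ 2) *
      exp (- sg * 2 * M * c)) by ring.
    apply Rmult_le_pos; [| lra].
    destruct hsg as [-> | ->]; lra. }
split; intros h0.
- specialize (mono 1 (or_introl eq_refl)). rewrite h0 in mono.
  set (e := exp (- (1) * 2 * M * b)) in *.
  assert (0 < e) by apply exp_pos.
  assert (f b ^ 2 * e <= 0) by lra.
  assert (0 <= f b ^ 2) by apply pow2_ge_0.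
  apply Rsqr_0_uniq; unfold Rsqr; nra.
- specialize (mono (-1) (or_intror eq_refl)). rewrite h0 in mono.
  set (e := exp (- -1 * 2 * M * a)) in *.
  assert (0 < e) by apply exp_pos.
  assert (f a ^ 2 * e <= 0) by lra.
  assert (0 <= f a ^ 2) by apply pow2_ge_0.
  apply Rsqr_0_uniq; unfold Rsqr; nra.
Qed.

Lemma linear_ode_zero (I : R -> Prop) (f g : R -> R) (a b : R) :
  nondegenerate_interval I ->
  (forall s, I s -> is_derive f s (g s * f s)) ->
  (forall s, I s -> continuity_pt g s) ->
  I a -> I b -> f a = 0 -> f b = 0.
Proof.
intros [conv _] df cg.
assert (ord : forall u v, I u -> I v -> u <= v -> (f u = 0 <-> f v = 0)).
{ intros u v Iu Iv uv.
  destruct (continuity_ab_maj (fun s => Rabs (g s)) u v uv) as [m [hm _]].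
  { intros s hs. apply (continuity_pt_comp g Rabs).
    - apply cg, (conv u v); assumption.
    - apply Rcontinuity_abs. }
  apply (ode_bound_zero f (fun s => g s * f s) (Rabs (g m))); [assumption | |].
  - intros s hs; apply df, (conv u v); assumption.
  - intros s hs. rewrite Rabs_mult.
    apply Rmult_le_compat_r; [apply Rabs_pos | apply hm, hs]. }
intros Ia Ib fa.
destruct (Rle_lt_dec a b) as [ab | ba].
- apply (ord a b); assumption.
- apply (ord b a); [assumption .. | lra | assumption].
Qed.

(** * Curves on the sphere and their moving frame *)

(** The first two derivatives are part of the data, and they are required to be
    derivatives at the points of [I] only.  Rotating the curve or permuting its
    coordinates then computes on components, with no appeal to [Derive]. *)
Record sphere_curve (I : R -> Prop) := SphereCurve {
  cx : R -> R; cy : R -> R; cz : R -> R;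
  dx : R -> R; dy : R -> R; dz : R -> R;
  ddx : R -> R; ddy : R -> R; ddz : R -> R;
  derive_cx : forall s, I s -> is_derive cx s (dx s);
  derive_cy : forall s, I s -> is_derive cy s (dy s);
  derive_cz : forall s, I s -> is_derive cz s (dz s);
  derive_dx : forall s, I s -> is_derive dx s (ddx s);
  derive_dy : forall s, I s -> is_derive dy s (ddy s);
  derive_dz : forall s, I s -> is_derive dz s (ddz s);
  on_sphere : forall s, I s -> cx s ^ 2 + cy s ^ 2 + cz s ^ 2 = 1;
  unit_speed : forall s, I s -> dx s ^ 2 + dy s ^ 2 + dz s ^ 2 = 1
}.
Arguments cx {I} _ _. Arguments cy {I} _ _. Arguments cz {I} _ _.
Arguments dx {I} _ _. Arguments dy {I} _ _. Arguments dz {I} _ _.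
Arguments ddx {I} _ _. Arguments ddy {I} _ _. Arguments ddz {I} _ _.

(** The spherical normal [nu], the cross product of position and velocity; its third
    component is the angular momentum about the axis [z]. *)
Definition nu1 {I} (c : sphere_curve I) s := cy c s * dz c s - cz c s * dy c s.
Definition nu2 {I} (c : sphere_curve I) s := cz c s * dx c s - cx c s * dz c s.
Definition nu3 {I} (c : sphere_curve I) s := cx c s * dy c s - cy c s * dx c s.

Definition curvature {I} (c : sphere_curve I) s :=
  nu1 c s * ddx c s + nu2 c s * ddy c s + nu3 c s * ddz c s.

(** Applies to the single curve in the context.  [auto_derive] leaves the derivatives of
    the components as eta-expanded [Derive] terms, which are replaced by the fields. *)
Ltac derive_curve :=
  match goal with
  | Is : ?I ?s |- is_derive _ ?s _ =>
    match goal with c : sphere_curve I |- _ =>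
    pose proof (derive_cx _ c s Is); pose proof (derive_cy _ c s Is);
    pose proof (derive_cz _ c s Is); pose proof (derive_dx _ c s Is);
    pose proof (derive_dy _ c s Is); pose proof (derive_dz _ c s Is);
    auto_derive;
    [ repeat split; try (eexists; eassumption) |
    repeat match goal with
    | H : is_derive ?f s ?l |- _ =>
        rewrite (is_derive_unique (fun u : R => f u) s l H); clear H
    end ]
    end
  end.

Lemma pos_vel (I : R -> Prop) (hI : nondegenerate_interval I)
    (c : sphere_curve I) (s : R) (Is : I s) :
  cx c s * dx c s + cy c s * dy c s + cz c s * dz c s = 0.
Proof.
assert (2 * (cx c s * dx c s + cy c s * dy c s + cz c s * dz c s) = 0); [| lra].
apply (derive_zero_of_constant I (fun u => cx c u ^ 2 + cy c u ^ 2 + cz c u ^ 2) 1 s);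
  [assumption | apply on_sphere | assumption |].
derive_curve. ring.
Qed.

Lemma vel_acc (I : R -> Prop) (hI : nondegenerate_interval I)
    (c : sphere_curve I) (s : R) (Is : I s) :
  dx c s * ddx c s + dy c s * ddy c s + dz c s * ddz c s = 0.
Proof.
assert (2 * (dx c s * ddx c s + dy c s * ddy c s + dz c s * ddz c s) = 0); [| lra].
apply (derive_zero_of_constant I (fun u => dx c u ^ 2 + dy c u ^ 2 + dz c u ^ 2) 1 s);
  [assumption | apply unit_speed | assumption |].
derive_curve. ring.
Qed.

Lemma pos_acc (I : R -> Prop) (hI : nondegenerate_interval I)
    (c : sphere_curve I) (s : R) (Is : I s) :
  cx c s * ddx c s + cy c s * ddy c s + cz c s * ddz c s = - 1.
Proof.
pose proof (unit_speed _ c s Is).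
assert (dx c s ^ 2 + dy c s ^ 2 + dz c s ^ 2 +
  (cx c s * ddx c s + cy c s * ddy c s + cz c s * ddz c s) = 0); [| lra].
apply (derive_zero_of_constant I
  (fun u => cx c u * dx c u + cy c u * dy c u + cz c u * dz c u) 0 s);
  [assumption | intros; apply pos_vel; assumption | assumption |].
derive_curve. ring.
Qed.

(** An orthonormal pair and its cross product form an orthonormal basis.  Only the first
    component is stated: the other two follow by permuting coordinates cyclically,
    which preserves the cross product. *)
Lemma frame_expansion (x y z x' y' z' v1 v2 v3 : R) :
  x ^ 2 + y ^ 2 + z ^ 2 = 1 -> x' ^ 2 + y' ^ 2 + z' ^ 2 = 1 ->
  x * x' + y * y' + z * z' = 0 ->
  (x * v1 + y * v2 + z * v3) * x + (x' * v1 + y' * v2 + z' * v3) * x' +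
  ((y * z' - z * y') * v1 + (z * x' - x * z') * v2 + (x * y' - y * x') * v3) *
    (y * z' - z * y') = v1.
Proof.
intros e e' o.
assert (zz : z * z' = - (x * x' + y * y')) by lra.
assert (z2 : z ^ 2 = 1 - x ^ 2 - y ^ 2) by lra.
assert (z2' : z' ^ 2 = 1 - x' ^ 2 - y' ^ 2) by lra.
assert (y2 : y ^ 2 = 1 - x ^ 2 - z ^ 2) by lra.
assert (y2' : y' ^ 2 = 1 - x' ^ 2 - z' ^ 2) by lra.
assert (yy : y * y' = - (x * x' + z * z')) by lra.
assert (c1 : x ^ 2 + x' ^ 2 + (y * z' - z * y') ^ 2 = 1).
{ replace ((y * z' - z * y') ^ 2)
    with ((y ^ 2 + z ^ 2) * (y' ^ 2 + z' ^ 2) - (y * y' + z * z') ^ 2) by ring.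
  replace (y ^ 2 + z ^ 2) with (1 - x ^ 2) by lra.
  replace (y' ^ 2 + z' ^ 2) with (1 - x' ^ 2) by lra.
  replace (y * y' + z * z') with (- (x * x')) by lra. ring. }
assert (c2 : x * y + x' * y' + (y * z' - z * y') * (z * x' - x * z') = 0).
{ replace ((y * z' - z * y') * (z * x' - x * z')) with
    ((x' * y + x * y') * (z * z') - x * y * z' ^ 2 - x' * y' * z ^ 2) by ring.
  rewrite zz, z2, z2'. ring. }
assert (c3 : x * z + x' * z' + (y * z' - z * y') * (x * y' - y * x') = 0).
{ replace ((y * z' - z * y') * (x * y' - y * x')) with
    ((x' * z + x * z') * (y * y') - x * z * y' ^ 2 - x' * z' * y ^ 2) by ring.
  rewrite yy, y2, y2'. ring. }
transitivity (v1 * 1 + v2 * 0 + v3 * 0); [| ring].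
rewrite <- c1, <- c2 at 1. rewrite <- c3 at 1. ring.
Qed.

(** Cyclic permutation of the coordinates: it sends [nu1], [nu2], [nu3] to [nu2],
    [nu3], [nu1], so every formula for one component yields the other two. *)
Definition roll {I} (c : sphere_curve I) : sphere_curve I.
Proof.
refine (SphereCurve I (cy c) (cz c) (cx c) (dy c) (dz c) (dx c) (ddy c) (ddz c) (ddx c)
  (derive_cy _ c) (derive_cz _ c) (derive_cx _ c)
  (derive_dy _ c) (derive_dz _ c) (derive_dx _ c) _ _); intros s Is.
- pose proof (on_sphere _ c s Is); lra.
- pose proof (unit_speed _ c s Is); lra.
Defined.

Lemma curvature_roll {I} (c : sphere_curve I) s : curvature (roll c) s = curvature c s.
Proof. unfold curvature, nu1, nu2, nu3; simpl; ring. Qed.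

Lemma accel_x {I} (hI : nondegenerate_interval I) (c : sphere_curve I) s : I s ->
  ddx c s = - cx c s + curvature c s * nu1 c s.
Proof.
intros Is.
rewrite <- (frame_expansion (cx c s) (cy c s) (cz c s) (dx c s) (dy c s) (dz c s)
   (ddx c s) (ddy c s) (ddz c s) (on_sphere _ c s Is) (unit_speed _ c s Is)
   (pos_vel _ hI c s Is)) at 1.
rewrite (pos_acc _ hI c s Is), (vel_acc _ hI c s Is).
unfold curvature, nu1, nu2, nu3; ring.
Qed.

Lemma accel_y {I} (hI : nondegenerate_interval I) (c : sphere_curve I) s : I s ->
  ddy c s = - cy c s + curvature c s * nu2 c s.
Proof.
intros Is. rewrite <- (curvature_roll c). exact (accel_x hI (roll c) s Is).
Qed.

Lemma accel_z {I} (hI : nondegenerate_interval I) (c : sphere_curve I) s : I s ->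
  ddz c s = - cz c s + curvature c s * nu3 c s.
Proof.
intros Is. rewrite <- (curvature_roll c). exact (accel_y hI (roll c) s Is).
Qed.

Lemma nu_unit {I} (hI : nondegenerate_interval I) (c : sphere_curve I) s : I s ->
  nu1 c s ^ 2 + nu2 c s ^ 2 + nu3 c s ^ 2 = 1.
Proof.
intros Is.
transitivity ((cx c s ^ 2 + cy c s ^ 2 + cz c s ^ 2) * (dx c s ^ 2 + dy c s ^ 2 + dz c s ^ 2)
  - (cx c s * dx c s + cy c s * dy c s + cz c s * dz c s) ^ 2);
  [unfold nu1, nu2, nu3; ring |].
rewrite (on_sphere _ c s Is), (unit_speed _ c s Is), (pos_vel _ hI c s Is). ring.
Qed.

Lemma nu_pos {I} (c : sphere_curve I) s :
  nu1 c s * cx c s + nu2 c s * cy c s + nu3 c s * cz c s = 0.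
Proof. unfold nu1, nu2, nu3; ring. Qed.

Lemma pos_cross_nu {I} (hI : nondegenerate_interval I) (c : sphere_curve I) s : I s ->
  cy c s * nu3 c s - cz c s * nu2 c s = - dx c s.
Proof.
intros Is.
transitivity (cx c s * (cx c s * dx c s + cy c s * dy c s + cz c s * dz c s)
  - dx c s * (cx c s ^ 2 + cy c s ^ 2 + cz c s ^ 2)); [unfold nu2, nu3; ring |].
rewrite (pos_vel _ hI c s Is), (on_sphere _ c s Is); ring.
Qed.

Lemma nu_cross_vel {I} (hI : nondegenerate_interval I) (c : sphere_curve I) s : I s ->
  nu2 c s * dz c s - nu3 c s * dy c s = - cx c s.
Proof.
intros Is.
transitivity (dx c s * (cx c s * dx c s + cy c s * dy c s + cz c s * dz c s)
  - cx c s * (dx c s ^ 2 + dy c s ^ 2 + dz c s ^ 2)); [unfold nu2, nu3; ring |].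
rewrite (pos_vel _ hI c s Is), (unit_speed _ c s Is); ring.
Qed.

(** [nu' = xi x xi''] and [xi'' = - xi + kappa nu], so [nu' = kappa (xi x nu) = - kappa T]. *)
Lemma derive_nu1 {I} (hI : nondegenerate_interval I) (c : sphere_curve I) s : I s ->
  is_derive (nu1 c) s (- curvature c s * dx c s).
Proof.
intros Is. unfold nu1 at 1.
derive_curve.
rewrite (accel_z hI c s Is), (accel_y hI c s Is).
transitivity (curvature c s * (cy c s * nu3 c s - cz c s * nu2 c s)); [ring |].
rewrite (pos_cross_nu hI c s Is). ring.
Qed.

Lemma derive_nu2 {I} (hI : nondegenerate_interval I) (c : sphere_curve I) s : I s ->
  is_derive (nu2 c) s (- curvature c s * dy c s).
Proof.
intros Is. rewrite <- (curvature_roll c). exact (derive_nu1 hI (roll c) s Is).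
Qed.

Lemma derive_nu3 {I} (hI : nondegenerate_interval I) (c : sphere_curve I) s : I s ->
  is_derive (nu3 c) s (- curvature c s * dz c s).
Proof.
intros Is. rewrite <- (curvature_roll c). exact (derive_nu2 hI (roll c) s Is).
Qed.

(** * The cubic relation and spherical conics *)

(** The relation between the principal curvatures, cleared of denominators and of the
    choice of unit normal. *)
Definition cubic {I} (c : sphere_curve I) (m : R) :=
  forall s, I s -> curvature c s * cz c s ^ 3 = m * nu3 c s ^ 3.

Lemma cubic_curvature {I} (c : sphere_curve I) m s :
  cubic c m -> I s -> cz c s <> 0 -> curvature c s = m * nu3 c s ^ 3 / cz c s ^ 3.
Proof.
intros hm Is z0. rewrite <- (hm s Is). field; assumption.
Qed.

(** [nu3' = - kappa z'] and [kappa] is a multiple of [nu3^3], so [nu3] solves a linear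
    equation with continuous coefficient. *)
Lemma nu3_zero_or_nonzero {I} (hI : nondegenerate_interval I) (c : sphere_curve I) m :
  (forall s, I s -> cz c s <> 0) -> cubic c m ->
  (forall s, I s -> nu3 c s = 0) \/ (forall s, I s -> nu3 c s <> 0).
Proof.
intros hz hm.
destruct (classic (exists a, I a /\ nu3 c a = 0)) as [[a [Ia a0]] | no];
  [left | right; intros s Is s0; apply no; exists s; split; assumption].
intros b Ib.
apply (linear_ode_zero I (nu3 c)
  (fun s => - m * nu3 c s ^ 2 * dz c s / cz c s ^ 3) a b); try assumption.
- intros s Is. pose proof (hz s Is).
  pose proof (derive_nu3 hI c s Is) as D.
  rewrite (cubic_curvature c m s hm Is) in D by assumption.
  replace (_ * nu3 c s) with (- (m * nu3 c s ^ 3 / cz c s ^ 3) * dz c s)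
    by (field; assumption).
  exact D.
- intros s Is. apply ex_derive_continuity_pt.
  pose proof (hz s Is). pose proof (derive_nu3 hI c s Is).
  pose proof (derive_cz _ c s Is). pose proof (derive_dz _ c s Is).
  auto_derive; repeat split; try (eexists; eassumption).
  apply pow_nonzero with (n := 3%nat); assumption.
Qed.

Lemma meridian_of_nu3_zero {I} (hI : nondegenerate_interval I) (c : sphere_curve I) m :
  (forall s, I s -> cz c s <> 0) -> cubic c m ->
  (forall s, I s -> nu3 c s = 0) ->
  exists n1 n2, n1 ^ 2 + n2 ^ 2 = 1 /\ forall s, I s -> n1 * cx c s + n2 * cy c s = 0.
Proof.
intros hz hm h0.
assert (k0 : forall s, I s -> curvature c s = 0).
{ intros s Is. rewrite (cubic_curvature c m s hm Is (hz s Is)), (h0 s Is).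
  field; exact (hz s Is). }
destruct (proj2 hI) as [a [_ [Ia _]]].
exists (nu1 c a), (nu2 c a). split.
- pose proof (nu_unit hI c a Ia) as U. rewrite (h0 a Ia) in U. lra.
- intros s Is.
  rewrite (constant_of_derive_zero I (nu1 c) a s hI), (constant_of_derive_zero I (nu2 c) a s hI);
    try assumption.
  + pose proof (nu_pos c s) as P. rewrite (h0 s Is) in P. lra.
  + intros u Iu. pose proof (derive_nu2 hI c u Iu) as D. rewrite (k0 u Iu) in D.
    replace 0 with (- 0 * dy c u) by ring. exact D.
  + intros u Iu. pose proof (derive_nu1 hI c u Iu) as D. rewrite (k0 u Iu) in D.
    replace 0 with (- 0 * dx c u) by ring. exact D.
Qed.

(** Up to sign the numerators are components of [nu x nu' = - kappa (nu x T) = kappa xi]. *)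
Lemma derive_dual {I} (hI : nondegenerate_interval I) (c : sphere_curve I) s :
  I s -> nu3 c s <> 0 ->
  is_derive (fun u => nu1 c u / nu3 c u) s (curvature c s * cy c s / nu3 c s ^ 2) /\
  is_derive (fun u => nu2 c u / nu3 c u) s (- curvature c s * cx c s / nu3 c s ^ 2).
Proof.
intros Is n0.
pose proof (derive_nu1 hI c s Is) as D1. pose proof (derive_nu2 hI c s Is) as D2.
pose proof (derive_nu3 hI c s Is) as D3.
split.
- replace (curvature c s * cy c s / nu3 c s ^ 2) with
    ((- curvature c s * dx c s * nu3 c s - nu1 c s * (- curvature c s * dz c s)) / nu3 c s ^ 2).
  + exact (is_derive_div (nu1 c) (nu3 c) s _ _ D1 D3 n0).
  + pose proof (nu_cross_vel hI (roll c) s Is : nu3 c s * dx c s - nu1 c s * dz c s = - cy c s)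
      as E.
    replace (cy c s) with (- (nu3 c s * dx c s - nu1 c s * dz c s)) by lra.
    field; assumption.
- replace (- curvature c s * cx c s / nu3 c s ^ 2) with
    ((- curvature c s * dy c s * nu3 c s - nu2 c s * (- curvature c s * dz c s)) / nu3 c s ^ 2).
  + exact (is_derive_div (nu2 c) (nu3 c) s _ _ D2 D3 n0).
  + pose proof (nu_cross_vel hI c s Is) as E.
    replace (cx c s) with (- (nu2 c s * dz c s - nu3 c s * dy c s)) by lra.
    field; assumption.
Qed.

(** Up to sign the numerators are components of [xi x xi' = nu]. *)
Lemma derive_gnomonic {I} (c : sphere_curve I) s :
  I s -> cz c s <> 0 ->
  is_derive (fun u => cx c u / cz c u) s (nu2 c s / cz c s ^ 2) /\
  is_derive (fun u => cy c u / cz c u) s (- nu1 c s / cz c s ^ 2).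
Proof.
intros Is z0. split.
- replace (nu2 c s / cz c s ^ 2) with
   ((dx c s * cz c s - cx c s * dz c s) / cz c s ^ 2) by (unfold nu2; field; assumption).
  exact (is_derive_div (cx c) (cz c) s _ _ (derive_cx _ c s Is) (derive_cz _ c s Is) z0).
- replace (- nu1 c s / cz c s ^ 2) with
   ((dy c s * cz c s - cy c s * dz c s) / cz c s ^ 2) by (unfold nu1; field; assumption).
  exact (is_derive_div (cy c) (cz c) s _ _ (derive_cy _ c s Is) (derive_cz _ c s Is) z0).
Qed.

(** In the gnomonic chart the cubic relation says that the pairs [(X, Y)] and [(U, V)]
    solve a linear system with constant coefficients, up to a common time change,
    and the coefficients of the conic are first integrals of this system.  On the curve the quadratic form
    collapses to [(U X + V Y)^2], because the terms in [m] cancel, and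
    [U X + V Y = -1] by orthogonality of [nu] and [xi]. *)
Lemma conic_of_cubic {I} (hI : nondegenerate_interval I) (c : sphere_curve I) m :
  (forall s, I s -> cz c s <> 0) -> cubic c m ->
  (forall s, I s -> nu3 c s <> 0) ->
  exists al be ga, forall s, I s ->
    al * cx c s ^ 2 + 2 * be * cx c s * cy c s + ga * cy c s ^ 2 = cz c s ^ 2.
Proof.
intros hz hm h0.
set (X := fun s => cx c s / cz c s). set (Y := fun s => cy c s / cz c s).
set (U := fun s => nu1 c s / nu3 c s). set (V := fun s => nu2 c s / nu3 c s).
assert (D : forall s, I s ->
  is_derive X s (nu2 c s / cz c s ^ 2) /\ is_derive Y s (- nu1 c s / cz c s ^ 2) /\
  is_derive U s (m * nu3 c s * cy c s / cz c s ^ 3) /\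
  is_derive V s (- m * nu3 c s * cx c s / cz c s ^ 3)).
{ intros s Is. pose proof (hz s Is) as z0. pose proof (h0 s Is) as n0.
  destruct (derive_gnomonic c s Is z0) as [DX DY].
  destruct (derive_dual hI c s Is n0) as [DU DV].
  rewrite (cubic_curvature c m s hm Is z0) in DU, DV.
  split; [exact DX | split; [exact DY | split]].
  - replace (m * nu3 c s * cy c s / cz c s ^ 3) with
      (m * nu3 c s ^ 3 / cz c s ^ 3 * cy c s / nu3 c s ^ 2)
      by (field; split; assumption). exact DU.
  - replace (- m * nu3 c s * cx c s / cz c s ^ 3) with
      (- (m * nu3 c s ^ 3 / cz c s ^ 3) * cx c s / nu3 c s ^ 2)
      by (field; split; assumption). exact DV. }
destruct (proj2 hI) as [a [_ [Ia _]]].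
exists (U a ^ 2 + m * Y a ^ 2), (U a * V a - m * X a * Y a), (V a ^ 2 + m * X a ^ 2).
intros s Is.
assert (C : forall f : R -> R, (forall u, I u -> is_derive f u 0) -> f a = f s)
  by (intros f df; apply (constant_of_derive_zero I f a s hI df Ia Is)).
pose proof (C (fun u => U u ^ 2 + m * Y u ^ 2)) as C1.
pose proof (C (fun u => U u * V u - m * X u * Y u)) as C2.
pose proof (C (fun u => V u ^ 2 + m * X u ^ 2)) as C3.
simpl in C1, C2, C3 |- *.
rewrite C1, C2, C3; clear C C1 C2 C3.
- pose proof (hz s Is). pose proof (h0 s Is).
  transitivity ((- (nu1 c s * cx c s + nu2 c s * cy c s) / nu3 c s) ^ 2).
  + unfold U, V, X, Y; field; split; assumption.
  + replace (- (nu1 c s * cx c s + nu2 c s * cy c s)) with (nu3 c s * cz c s)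
      by (pose proof (nu_pos c s); lra).
    field; assumption.
- intros u Iu; destruct (D u Iu) as [DX [DY [DU DV]]].
  auto_derive; [repeat split; try (eexists; eassumption) |].
  rewrite (is_derive_unique (fun x : R => V x) u _ DV).
  rewrite (is_derive_unique (fun x : R => X x) u _ DX).
  unfold U, V, X, Y; field; auto.
- intros u Iu; destruct (D u Iu) as [DX [DY [DU DV]]].
  auto_derive; [repeat split; try (eexists; eassumption) |].
  rewrite (is_derive_unique (fun x : R => U x) u _ DU).
  rewrite (is_derive_unique (fun x : R => V x) u _ DV).
  rewrite (is_derive_unique (fun x : R => X x) u _ DX).
  rewrite (is_derive_unique (fun x : R => Y x) u _ DY).
  unfold U, V, X, Y; field; auto.
- intros u Iu; destruct (D u Iu) as [DX [DY [DU DV]]].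
  auto_derive; [repeat split; try (eexists; eassumption) |].
  rewrite (is_derive_unique (fun x : R => U x) u _ DU).
  rewrite (is_derive_unique (fun x : R => Y x) u _ DY).
  unfold U, V, X, Y; field; auto.
Qed.

Lemma conic_pole_along_normal (x y z u1 u2 u3 q1 q2 q3 : R) :
  x ^ 2 + y ^ 2 + z ^ 2 = 1 -> u1 ^ 2 + u2 ^ 2 + u3 ^ 2 = 1 ->
  x * u1 + y * u2 + z * u3 = 0 -> q1 * x ^ 2 + q2 * y ^ 2 + q3 * z ^ 2 = 0 ->
  q1 * x * u1 + q2 * y * u2 + q3 * z * u3 = 0 ->
  exists l : R, q1 * x = l * (y * u3 - z * u2) /\ q2 * y = l * (z * u1 - x * u3) /\
    q3 * z = l * (x * u2 - y * u1).
Proof.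
intros e e' o q q'.
exists ((y * u3 - z * u2) * (q1 * x) + (z * u1 - x * u3) * (q2 * y) +
        (x * u2 - y * u1) * (q3 * z)).
pose proof (frame_expansion x y z u1 u2 u3 (q1 * x) (q2 * y) (q3 * z) e e' o) as E1.
pose proof (frame_expansion y z x u2 u3 u1 (q2 * y) (q3 * z) (q1 * x)) as E2.
pose proof (frame_expansion z x y u3 u1 u2 (q3 * z) (q1 * x) (q2 * y)) as E3.
specialize (E2 ltac:(lra) ltac:(lra) ltac:(lra)).
specialize (E3 ltac:(lra) ltac:(lra) ltac:(lra)).
repeat split.
- rewrite <- E1 at 1.
  replace (x * (q1 * x) + y * (q2 * y) + z * (q3 * z)) with 0 by lra.
  replace (u1 * (q1 * x) + u2 * (q2 * y) + u3 * (q3 * z)) with 0 by lra. ring.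
- rewrite <- E2 at 1.
  replace (y * (q2 * y) + z * (q3 * z) + x * (q1 * x)) with 0 by lra.
  replace (u2 * (q2 * y) + u3 * (q3 * z) + u1 * (q1 * x)) with 0 by lra. ring.
- rewrite <- E3 at 1.
  replace (z * (q3 * z) + x * (q1 * x) + y * (q2 * y)) with 0 by lra.
  replace (u3 * (q3 * z) + u1 * (q1 * x) + u2 * (q2 * y)) with 0 by lra. ring.
Qed.

Lemma conic_tangent {I} (hI : nondegenerate_interval I) (c : sphere_curve I) (q1 q2 q3 : R) :
  (forall s, I s -> q1 * cx c s ^ 2 + q2 * cy c s ^ 2 + q3 * cz c s ^ 2 = 0) ->
  forall s, I s -> q1 * cx c s * dx c s + q2 * cy c s * dy c s + q3 * cz c s * dz c s = 0.
Proof.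
intros hq s Is.
assert (2 * (q1 * cx c s * dx c s + q2 * cy c s * dy c s + q3 * cz c s * dz c s) = 0); [| lra].
apply (derive_zero_of_constant I
  (fun u => q1 * cx c u ^ 2 + q2 * cy c u ^ 2 + q3 * cz c u ^ 2) 0 s _ hI hq Is).
derive_curve. ring.
Qed.

(** The gradient of the conic is orthogonal to the position by homogeneity and to the
    velocity by differentiation. *)
Lemma conic_along_normal {I} (hI : nondegenerate_interval I) (c : sphere_curve I) (q1 q2 q3 : R) :
  (forall s, I s -> q1 * cx c s ^ 2 + q2 * cy c s ^ 2 + q3 * cz c s ^ 2 = 0) ->
  forall s, I s -> exists l : R, q1 * cx c s = l * nu1 c s /\
    q2 * cy c s = l * nu2 c s /\ q3 * cz c s = l * nu3 c s.
Proof.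
intros hq s Is.
apply conic_pole_along_normal; [apply on_sphere | apply unit_speed | apply pos_vel | apply hq
  | apply conic_tangent]; assumption.
Qed.

(** [l^3 kappa = det Q] where [Q xi = l nu]; the constant is [det Q / q3^3]. *)
Lemma cubic_of_conic {I} (hI : nondegenerate_interval I) (c : sphere_curve I) (q1 q2 q3 : R) :
  (forall s, I s -> cz c s <> 0) -> q3 <> 0 ->
  (forall s, I s -> q1 * cx c s ^ 2 + q2 * cy c s ^ 2 + q3 * cz c s ^ 2 = 0) ->
  cubic c (q1 * q2 / q3 ^ 2).
Proof.
intros hz q0 hq s Is. pose proof (hz s Is) as z0.
destruct (conic_along_normal hI c q1 q2 q3 hq s Is) as [l [E1 [E2 E3]]].
assert (l0 : l <> 0).
{ intros ->. rewrite Rmult_0_l in E3. apply Rmult_integral in E3. tauto. }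
assert (A : q1 * dx c s ^ 2 + q2 * dy c s ^ 2 + q3 * dz c s ^ 2 + l * curvature c s = 0).
{ apply (derive_zero_of_constant I (fun u =>
    q1 * cx c u * dx c u + q2 * cy c u * dy c u + q3 * cz c u * dz c u) 0 s _ hI
    (conic_tangent hI c q1 q2 q3 hq) Is).
  derive_curve.
  transitivity (q1 * dx c s ^ 2 + q2 * dy c s ^ 2 + q3 * dz c s ^ 2 +
    (q1 * cx c s * ddx c s + q2 * cy c s * ddy c s + q3 * cz c s * ddz c s)); [ring |].
  rewrite E1, E2, E3. unfold curvature; ring. }
assert (T1 : l * dx c s = (q2 - q3) * cy c s * cz c s).
{ transitivity (l * nu2 c s * cz c s - l * nu3 c s * cy c s);
  [pose proof (pos_cross_nu hI c s Is) | rewrite <- E2, <- E3; ring].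
  replace (dx c s) with (cz c s * nu2 c s - cy c s * nu3 c s) by lra. ring. }
assert (T2 : l * dy c s = (q3 - q1) * cz c s * cx c s).
{ transitivity (l * nu3 c s * cx c s - l * nu1 c s * cz c s);
  [pose proof (pos_cross_nu hI (roll c) s Is : cz c s * nu1 c s - cx c s * nu3 c s = - dy c s)
  | rewrite <- E1, <- E3; ring].
  replace (dy c s) with (cx c s * nu3 c s - cz c s * nu1 c s) by lra. ring. }
assert (T3 : l * dz c s = (q1 - q2) * cx c s * cy c s).
{ transitivity (l * nu1 c s * cy c s - l * nu2 c s * cx c s);
  [pose proof (pos_cross_nu hI (roll (roll c)) s Is
     : cx c s * nu2 c s - cy c s * nu1 c s = - dz c s)
  | rewrite <- E1, <- E2; ring].
  replace (dz c s) with (cy c s * nu1 c s - cx c s * nu2 c s) by lra. ring. }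
assert (L : l ^ 3 * curvature c s = q1 * q2 * q3).
{ transitivity (- (q1 * (l * dx c s) ^ 2 + q2 * (l * dy c s) ^ 2 + q3 * (l * dz c s) ^ 2)).
  - replace (l ^ 3 * curvature c s) with (l ^ 2 * (l * curvature c s)) by ring.
    replace (l * curvature c s) with
      (- (q1 * dx c s ^ 2 + q2 * dy c s ^ 2 + q3 * dz c s ^ 2)) by lra. ring.
  - rewrite T1, T2, T3.
    (* On the cone [<Q xi, xi> = 0], the form takes the value [- det Q |xi|^4] at
       [xi x Q xi]. *)
    transitivity (q1 * q2 * q3 * (cx c s ^ 2 + cy c s ^ 2 + cz c s ^ 2) ^ 2 -
      (q1 * cx c s ^ 2 + q2 * cy c s ^ 2 + q3 * cz c s ^ 2) *
      (q2 * q3 * cx c s ^ 2 + q1 * q3 * cy c s ^ 2 + q1 * q2 * cz c s ^ 2)); [ring |].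
    rewrite (on_sphere _ c s Is), (hq s Is); ring. }
apply (Rmult_eq_reg_l (l ^ 3)); [| apply pow_nonzero; assumption].
transitivity (q1 * q2 / q3 ^ 2 * (l * nu3 c s) ^ 3); [| ring].
rewrite <- E3, <- Rmult_assoc, L. field; assumption.
Qed.

(** * Curves fill a neighbourhood in their conic *)

Definition det3 a1 a2 a3 b1 b2 b3 c1 c2 c3 : R :=
  a1 * (b2 * c3 - b3 * c2) + a2 * (b3 * c1 - b1 * c3) + a3 * (b1 * c2 - b2 * c1).

Lemma det3_kernel a1 a2 a3 b1 b2 b3 c1 c2 c3 v1 v2 v3 :
  det3 a1 a2 a3 b1 b2 b3 c1 c2 c3 <> 0 ->
  a1 * v1 + a2 * v2 + a3 * v3 = 0 -> b1 * v1 + b2 * v2 + b3 * v3 = 0 ->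
  c1 * v1 + c2 * v2 + c3 * v3 = 0 -> v1 = 0 /\ v2 = 0 /\ v3 = 0.
Proof.
intros d0 ea eb ec.
assert (cramer : forall v w1 w2 w3, det3 a1 a2 a3 b1 b2 b3 c1 c2 c3 * v =
  (a1 * v1 + a2 * v2 + a3 * v3) * w1 + (b1 * v1 + b2 * v2 + b3 * v3) * w2 +
  (c1 * v1 + c2 * v2 + c3 * v3) * w3 -> v = 0).
{ intros v w1 w2 w3. rewrite ea, eb, ec. intros E.
  apply (Rmult_eq_reg_l (det3 a1 a2 a3 b1 b2 b3 c1 c2 c3)); [lra | assumption]. }
repeat split.
- apply (cramer _ (b2 * c3 - b3 * c2) (c2 * a3 - c3 * a2) (a2 * b3 - a3 * b2)).
  unfold det3; ring.
- apply (cramer _ (b3 * c1 - b1 * c3) (c3 * a1 - c1 * a3) (a3 * b1 - a1 * b3)).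
  unfold det3; ring.
- apply (cramer _ (b1 * c2 - b2 * c1) (c1 * a2 - c2 * a1) (a1 * b2 - a2 * b1)).
  unfold det3; ring.
Qed.

Lemma polar_angle (a b : R) : a ^ 2 + b ^ 2 = 1 -> exists t, a = cos t /\ b = sin t.
Proof.
intros e.
assert (ha : -1 <= a <= 1) by (pose proof (pow2_ge_0 b); nra).
assert (sb : sqrt (1 - a ^ 2) = Rabs b).
{ replace (1 - a ^ 2) with (Rsqr b) by (unfold Rsqr; lra). apply sqrt_Rsqr_abs. }
pose proof (sin_acos a ha) as S. rewrite Rsqr_pow2, sb in S.
destruct (Rle_dec 0 b) as [b0 | b0].
- exists (acos a). rewrite cos_acos, S, Rabs_pos_eq; auto.
- exists (- acos a). rewrite cos_neg, sin_neg, cos_acos, S by assumption.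
  rewrite Rabs_left; [split; ring | lra].
Qed.

Lemma polar_coordinates (r a b : R) : r <> 0 -> a ^ 2 + b ^ 2 = r ^ 2 ->
  exists t, a = r * cos t /\ b = r * sin t.
Proof.
intros r0 e.
destruct (polar_angle (a / r) (b / r)) as [t [Ea Eb]].
- transitivity ((a ^ 2 + b ^ 2) / r ^ 2); [field; assumption |].
  rewrite e; field; assumption.
- exists t. rewrite <- Ea, <- Eb; split; field; assumption.
Qed.

Lemma continuous_Rplus {T : UniformSpace} (f g : T -> R) (p : T) :
  continuous f p -> continuous g p -> continuous (fun q => f q + g q) p.
Proof. exact (continuous_plus (V := R_NormedModule) f g p). Qed.

Lemma continuous_Rminus {T : UniformSpace} (f g : T -> R) (p : T) :
  continuous f p -> continuous g p -> continuous (fun q => f q - g q) p.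
Proof. exact (continuous_minus (V := R_NormedModule) f g p). Qed.

Lemma continuous_Rmult {T : UniformSpace} (f g : T -> R) (p : T) :
  continuous f p -> continuous g p -> continuous (fun q => f q * g q) p.
Proof. exact (continuous_mult (K := R_AbsRing) f g p). Qed.

Lemma continuous_x1 (p : R4) : continuous x1 p.
Proof.
apply (continuous_ext (fun q : R4 => fst (fst (fst q)))); [intros [[[? ?] ?] ?]; reflexivity |].
destruct p as [[[p1 p2] p3] p4].
apply (continuous_comp (fun q : R4 => fst (fst q)) fst); [| apply continuous_fst].
apply (continuous_comp (fun q : R4 => fst q) fst); apply continuous_fst.
Qed.

Lemma continuous_x2 (p : R4) : continuous x2 p.
Proof.
apply (continuous_ext (fun q : R4 => snd (fst (fst q)))); [intros [[[? ?] ?] ?]; reflexivity |].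
destruct p as [[[p1 p2] p3] p4].
apply (continuous_comp (fun q : R4 => fst (fst q)) snd); [| apply continuous_snd].
apply (continuous_comp (fun q : R4 => fst q) fst); apply continuous_fst.
Qed.

Lemma continuous_x3 (p : R4) : continuous x3 p.
Proof.
apply (continuous_ext (fun q : R4 => snd (fst q))); [intros [[[? ?] ?] ?]; reflexivity |].
destruct p as [[[p1 p2] p3] p4].
apply (continuous_comp (fun q : R4 => fst q) snd); [apply continuous_fst | apply continuous_snd].
Qed.

Lemma continuous_x4 (p : R4) : continuous x4 p.
Proof.
apply (continuous_ext (fun q : R4 => snd q)); [intros [[[? ?] ?] ?]; reflexivity |].
destruct p as [[[p1 p2] p3] p4]. apply continuous_snd.
Qed.

Definition radius (p : R4) : R := sqrt (x3 p ^ 2 + x4 p ^ 2).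

Lemma radius_sqr (p : R4) : radius p ^ 2 = x3 p ^ 2 + x4 p ^ 2.
Proof.
apply pow2_sqrt. pose proof (pow2_ge_0 (x3 p)); pose proof (pow2_ge_0 (x4 p)); lra.
Qed.

Ltac prove_continuous :=
  cbv beta zeta;
  lazymatch goal with
  | |- continuous (fun q => _ + _) _ => apply continuous_Rplus; prove_continuous
  | |- continuous (fun q => _ - _) _ => apply continuous_Rminus; prove_continuous
  | |- continuous (fun q => _ * _) _ => apply continuous_Rmult; prove_continuous
  | H : ?G |- ?G => exact H
  | |- _ => apply continuous_const
  end.

Lemma continuous_radius (p : R4) : continuous radius p.
Proof.
apply (continuous_comp (fun q => x3 q ^ 2 + x4 q ^ 2) sqrt); [| apply continuous_sqrt].
pose proof (continuous_x3 p). pose proof (continuous_x4 p).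
simpl; prove_continuous.
Qed.

Lemma radius_rot_param (x y z : R -> R) s t : radius (rot_param x y z s t) = Rabs (z s).
Proof.
unfold radius; simpl.
rewrite <- (sqrt_Rsqr_abs (z s)). f_equal. unfold Rsqr.
transitivity (z s * z s * (sin t ^ 2 + cos t ^ 2)); [ring |].
rewrite <- !Rsqr_pow2, sin2_cos2; ring.
Qed.

(** The projection of the curve to its tangent line at [s] has derivative 1 there, so
    it takes values on both sides of its value at [s] arbitrarily close to [s]. *)
Lemma curve_covers_tangent {I} (c : sphere_curve I) s (P : R -> Prop) :
  locally s (fun u => I u /\ P u) -> I s ->
  exists e : posreal, forall v,
    Rabs (v - (dx c s * cx c s + dy c s * cy c s + dz c s * cz c s)) < e ->
    exists u, P u /\ dx c s * cx c u + dy c s * cy c u + dz c s * cz c u = v.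
Proof.
intros [d dP] Is.
set (phi := fun u => dx c s * cx c u + dy c s * cy c u + dz c s * cz c u).
assert (dphi : forall u, I u -> is_derive phi u
  (dx c s * dx c u + dy c s * dy c u + dz c s * dz c u)).
{ intros u Iu. unfold phi.
  pose proof (derive_cx _ c u Iu) as Hx. pose proof (derive_cy _ c u Iu) as Hy.
  pose proof (derive_cz _ c u Iu) as Hz.
  auto_derive; [repeat split; try (eexists; eassumption) |].
  rewrite (is_derive_unique (fun x : R => cx c x) u _ Hx),
    (is_derive_unique (fun x : R => cy c x) u _ Hy),
    (is_derive_unique (fun x : R => cz c x) u _ Hz). ring. }
pose proof (dphi s Is) as D. apply is_derive_Reals in D.
replace (dx c s * dx c s + dy c s * dy c s + dz c s * dz c s) with 1 in D
  by (pose proof (unit_speed _ c s Is); lra).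
destruct (D (1 / 2) ltac:(lra)) as [d' dP'].
pose proof (cond_pos d) as d0. pose proof (cond_pos d') as d0'.
set (h := Rmin (d / 2) (d' / 2)).
assert (h0 : 0 < h) by (apply Rmin_glb_lt; lra).
assert (hd : h <= d / 2) by apply Rmin_l. assert (hd' : h <= d' / 2) by apply Rmin_r.
assert (right : phi (s + h) >= phi s + h / 2).
{ specialize (dP' h ltac:(lra)). rewrite Rabs_pos_eq in dP' by lra.
  specialize (dP' ltac:(lra)). apply Rabs_lt_between in dP'.
  assert (E : (phi (s + h) - phi s) / h * h = phi (s + h) - phi s) by (field; lra). nra. }
assert (left : phi (s - h) <= phi s - h / 2).
{ specialize (dP' (- h) ltac:(lra)). rewrite Rabs_Ropp, Rabs_pos_eq in dP' by lra.
  specialize (dP' ltac:(lra)). apply Rabs_lt_between in dP'.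
  change (s + - h) with (s - h) in dP'.
  assert (E : (phi (s - h) - phi s) / (- h) * h = - (phi (s - h) - phi s)) by (field; lra). nra. }
assert (e0 : 0 < h / 2) by lra.
exists (mkposreal _ e0); simpl; intros v hv. fold (phi s) in hv.
apply Rabs_lt_between in hv.
assert (near : forall u, s - h <= u <= s + h -> I u /\ P u).
{ intros u hu. apply dP. change (Rabs (u - s) < d). apply Rabs_lt_between; lra. }
destruct (IVT_interv (fun u => phi u - v) (s - h) (s + h)) as [u [hu E]]; [| lra | lra | lra |].
- intros u hu. apply ex_derive_continuity_pt.
  pose proof (dphi u (proj1 (near u hu))). auto_derive. eexists; eassumption.
- exists u; split; [apply near, hu | fold (phi u); lra].
Qed.

(** The open set consists of the points near which [S] is contained in the image.  To see
    that it contains the image, fold a nearby point [p] of [S] to the half-plane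
    of the curve, as [q], and let [q'] be the point of the curve with the same
    projection to the tangent line.  Both the sphere and the second equation,
    call it [G], have degree two, so their differences at [q] and [q'] are linear in [q - q']
    with coefficients [q + q'] and a mean gradient; the determinant of these
    rows with [T] is close to [det (T, 2 xi, grad G) = - 2 <nu, grad G>],
    which is nonzero, and [q = q'] follows.  The linear term [b] allows for the
    planes [y = d]. *)
Lemma open_part {I} (hI : nondegenerate_interval I) (c : sphere_curve I)
    (S : R4 -> Prop) (q1 q2 q3 b d : R) :
  (forall s, I s -> cz c s <> 0) ->
  (forall p, S p -> sphere3 p /\
     q1 * x1 p ^ 2 + q2 * x2 p ^ 2 + q3 * (x3 p ^ 2 + x4 p ^ 2) + b * x2 p = d) ->
  (forall s, I s -> 2 * q1 * cx c s * nu1 c s + (2 * q2 * cy c s + b) * nu2 c s +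
     2 * q3 * cz c s * nu3 c s <> 0) ->
  (forall s t, I s -> S (rot_param (cx c) (cy c) (cz c) s t)) ->
  is_open_part_of I (rot_param (cx c) (cy c) (cz c)) S.
Proof.
intros hz hS nondeg inS. split; [exact inS |].
set (image := fun p => exists s t, locally s I /\ p = rot_param (cx c) (cy c) (cz c) s t).
exists (fun p => locally p (fun p' => S p' -> image p')).
split; [intros p hp; apply locally_locally, hp |].
intros p; split; [| intros [hp Sp]; exact (locally_singleton _ _ hp Sp)].
intros [s [t [ls ->]]].
assert (Is := locally_singleton _ _ ls).
split; [| apply inS, Is].
set (p0 := rot_param (cx c) (cy c) (cz c) s t).
(* [e] is the sign of [z s]: the curve keeps to one side of the axis near [s]. *)
assert (sgn : exists e, e ^ 2 = 1 /\ e * Rabs (cz c s) = cz c s).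
{ destruct (Rle_dec 0 (cz c s)).
  - exists 1; split; [ring | rewrite Rabs_pos_eq; lra].
  - exists (-1); split; [ring | rewrite Rabs_left; lra]. }
destruct sgn as [e [e2 ez]].
set (h := fun p => e * radius p).
assert (h0 : h p0 = cz c s) by (unfold h, p0; rewrite radius_rot_param; exact ez).
set (D := fun w : R4 * R => let p := fst w in let u := snd w in
  det3 (dx c s) (dy c s) (dz c s)
    (x1 p + cx c u) (x2 p + cy c u) (h p + cz c u)
    (q1 * (x1 p + cx c u)) (q2 * (x2 p + cy c u) + b) (q3 * (h p + cz c u))).
assert (D0 : D (p0, s) <> 0).
{ unfold D, det3; simpl fst; simpl snd. rewrite h0. simpl x1; simpl x2.
  specialize (nondeg s Is). intros E; apply nondeg.
  match type of E with ?l = 0 => transitivity (- / 2 * l); [| rewrite E; ring] end.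
  unfold nu1, nu2, nu3; field. }
assert (cD : continuous D (p0, s)).
{ assert (lift4 : forall f : R4 -> R, continuous f p0 ->
    continuous (fun w : R4 * R => f (fst w)) (p0, s))
    by (intros f cf; apply (continuous_comp fst f); [apply continuous_fst | exact cf]).
  assert (lift1 : forall f : R -> R, ex_derive f s ->
    continuous (fun w : R4 * R => f (snd w)) (p0, s))
    by (intros f df; apply (continuous_comp snd f); [apply continuous_snd |];
        exact (ex_derive_continuous (V := R_NormedModule) f s df)).
  pose proof (lift4 _ (continuous_x1 p0)). pose proof (lift4 _ (continuous_x2 p0)).
  pose proof (lift4 _ (continuous_radius p0)).
  pose proof (lift1 (cx c) (ex_intro _ _ (derive_cx _ c s Is))).
  pose proof (lift1 (cy c) (ex_intro _ _ (derive_cy _ c s Is))).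
  pose proof (lift1 (cz c) (ex_intro _ _ (derive_cz _ c s Is))).
  unfold D, det3, h. prove_continuous. }
assert (Dnear : locally (p0, s) (fun w => D w <> 0)).
{ apply (cD (fun v => v <> 0)). exists (mkposreal _ (Rabs_pos_lt _ D0)). intros y hy ->.
  change (Rabs (0 - D (p0, s)) < Rabs (D (p0, s))) in hy.
  rewrite Rminus_0_l, Rabs_Ropp in hy; lra. }
destruct Dnear as [r hr].
destruct (curve_covers_tangent c s (fun u => locally u I /\ ball s r u)) as [e' he'].
{ apply filter_and; [exact ls |]. apply filter_and; [apply locally_locally, ls |].
  exists r; auto. }
{ exact Is. }
assert (near : locally p0 (fun p => Rabs (dx c s * x1 p + dy c s * x2 p + dz c s * h p -
   (dx c s * cx c s + dy c s * cy c s + dz c s * cz c s)) < e')).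
{ assert (ch : continuous (fun p => dx c s * x1 p + dy c s * x2 p + dz c s * h p) p0).
  { pose proof (continuous_x1 p0). pose proof (continuous_x2 p0).
    pose proof (continuous_radius p0). unfold h; prove_continuous. }
  apply (ch (fun v => Rabs (v - (dx c s * cx c s + dy c s * cy c s + dz c s * cz c s)) < e')).
  rewrite h0. exists e'. intros v hv. exact hv. }
assert (nearr : locally p0 (ball p0 r)) by (exists r; auto).
generalize (filter_and _ _ near nearr). apply filter_imp.
intros p [hp hpr] Sp.
destruct (he' _ hp) as [u [[lu su] E]].
assert (Iu := locally_singleton _ _ lu).
destruct (hS p Sp) as [sp Gp].
destruct (hS _ (inS u 0 Iu)) as [_ Gu].
simpl x1 in Gu; simpl x2 in Gu; simpl x3 in Gu; simpl x4 in Gu.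
rewrite cos_0, sin_0 in Gu.
unfold sphere3, dot in sp.
pose proof (on_sphere _ c u Iu) as su2.
assert (hp2 : h p ^ 2 = x3 p ^ 2 + x4 p ^ 2)
  by (unfold h; rewrite Rpow_mult_distr, e2, radius_sqr; ring).
destruct (det3_kernel (dx c s) (dy c s) (dz c s)
    (x1 p + cx c u) (x2 p + cy c u) (h p + cz c u)
    (q1 * (x1 p + cx c u)) (q2 * (x2 p + cy c u) + b) (q3 * (h p + cz c u))
    (x1 p - cx c u) (x2 p - cy c u) (h p - cz c u)) as [E1 [E2 E3]].
- apply (hr (p, u)). split; assumption.
- lra.
- lra.
- transitivity (q1 * x1 p ^ 2 + q2 * x2 p ^ 2 + q3 * h p ^ 2 + b * x2 p -
    (q1 * cx c u ^ 2 + q2 * cy c u ^ 2 + q3 * cz c u ^ 2 + b * cy c u)); [ring |].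
  rewrite hp2. lra.
- destruct (polar_coordinates (cz c u) (x3 p) (x4 p) (hz u Iu)) as [t' [E3' E4']].
  + rewrite <- hp2. f_equal; lra.
  + exists u, t'. split; [exact lu |].
    destruct p as [[[p1 p2] p3] p4]. simpl in *.
    unfold rot_param, rotate. repeat apply (f_equal2 pair); lra.
Qed.

(** * Principal curvatures of the rotational surface *)

Lemma cos_sin_sqr t : cos t ^ 2 + sin t ^ 2 = 1.
Proof. rewrite <- !Rsqr_pow2, Rplus_comm. apply sin2_cos2. Qed.

Definition param {I} (c : sphere_curve I) : R -> R -> R4 := rot_param (cx c) (cy c) (cz c).

Lemma smooth_is_derive (I : R -> Prop) (f : R -> R) :
  smooth_on I f -> forall s, I s -> is_derive f s (Derive f s).
Proof. intros hf s Is. exact (Derive_correct _ _ (locally_singleton _ _ (hf 1%nat s Is))). Qed.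

Lemma smooth_is_derive2 (I : R -> Prop) (f : R -> R) :
  smooth_on I f -> forall s, I s -> is_derive (Derive f) s (Derive (Derive f) s).
Proof. intros hf s Is. exact (Derive_correct _ _ (locally_singleton _ _ (hf 2%nat s Is))). Qed.

Definition curve_of (I : R -> Prop) (x y z : R -> R)
    (h : unit_speed_spherical_curve I x y z) : sphere_curve I :=
  let hx := proj1 h in let hy := proj1 (proj2 h) in let hz := proj1 (proj2 (proj2 h)) in
  SphereCurve I x y z (Derive x) (Derive y) (Derive z)
    (Derive (Derive x)) (Derive (Derive y)) (Derive (Derive z))
    (smooth_is_derive I x hx) (smooth_is_derive I y hy) (smooth_is_derive I z hz)
    (smooth_is_derive2 I x hx) (smooth_is_derive2 I y hy) (smooth_is_derive2 I z hz)
    (proj1 (proj2 (proj2 (proj2 h)))) (proj2 (proj2 (proj2 (proj2 h)))).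

Definition turn {I} (a : R) (c : sphere_curve I) : sphere_curve I.
Proof.
refine (SphereCurve I
  (fun s => cos a * cx c s - sin a * cy c s) (fun s => sin a * cx c s + cos a * cy c s) (cz c)
  (fun s => cos a * dx c s - sin a * dy c s) (fun s => sin a * dx c s + cos a * dy c s) (dz c)
  (fun s => cos a * ddx c s - sin a * ddy c s) (fun s => sin a * ddx c s + cos a * ddy c s) (ddz c)
  _ _ (derive_cz _ c) _ _ (derive_dz _ c) _ _); intros s Is;
  try (derive_curve; ring).
- rewrite <- (on_sphere _ c s Is), <- (Rmult_1_l (cx c s ^ 2)), <- (Rmult_1_l (cy c s ^ 2)),
    <- (cos_sin_sqr a); ring.
- rewrite <- (unit_speed _ c s Is), <- (Rmult_1_l (dx c s ^ 2)), <- (Rmult_1_l (dy c s ^ 2)),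
    <- (cos_sin_sqr a); ring.
Defined.

Lemma nu3_turn {I} a (c : sphere_curve I) s : nu3 (turn a c) s = nu3 c s.
Proof.
unfold nu3; simpl.
transitivity ((cos a ^ 2 + sin a ^ 2) * (cx c s * dy c s - cy c s * dx c s)); [ring |].
rewrite cos_sin_sqr; ring.
Qed.

Lemma curvature_turn {I} a (c : sphere_curve I) s : curvature (turn a c) s = curvature c s.
Proof.
unfold curvature. rewrite nu3_turn; unfold nu1, nu2, nu3; simpl.
match goal with |- _ = ?r =>
  transitivity ((cos a ^ 2 + sin a ^ 2) * (r - nu3 c s * ddz c s) + nu3 c s * ddz c s) end;
  unfold nu3; [ring |].
rewrite cos_sin_sqr; ring.
Qed.

Lemma partial_s_rot (x y z : R -> R) s t :
  partial_s (rot_param x y z) s t = rot_param (Derive x) (Derive y) (Derive z) s t.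
Proof.
unfold partial_s, rot_param, rotate; simpl.
rewrite !Derive_scal_l. reflexivity.
Qed.

Lemma partial_ss_rot (x y z : R -> R) s t :
  partial_s (partial_s (rot_param x y z)) s t =
  rot_param (Derive (Derive x)) (Derive (Derive y)) (Derive (Derive z)) s t.
Proof.
rewrite <- partial_s_rot. unfold partial_s at 1 3.
repeat f_equal; apply functional_extensionality; intros u;
  rewrite (partial_s_rot x y z u t); reflexivity.
Qed.

Lemma partial_t_rot (x y z : R -> R) s t :
  partial_t (rot_param x y z) s t = (0, 0, - (z s * sin t), z s * cos t).
Proof.
unfold partial_t; simpl.
assert (Dc : Derive (fun u => z s * cos u) t = - (z s * sin t))
  by (apply is_derive_unique; auto_derive; [trivial | ring]).
assert (Ds : Derive (fun u => z s * sin u) t = z s * cos t)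
  by (apply is_derive_unique; auto_derive; [trivial | ring]).
rewrite !Derive_const, Dc, Ds. reflexivity.
Qed.

Lemma partial_tt_rot (x y z : R -> R) s t :
  partial_t (partial_t (rot_param x y z)) s t = (0, 0, - (z s * cos t), - (z s * sin t)).
Proof.
unfold partial_t at 1.
assert (E : forall f : R4 -> R, Derive (fun u => f (partial_t (rot_param x y z) s u)) t =
  Derive (fun u => f (0, 0, - (z s * sin u), z s * cos u)) t)
  by (intros f; apply Derive_ext; intros u; rewrite partial_t_rot; reflexivity).
rewrite !E; simpl.
assert (Dc : Derive (fun u => z s * cos u) t = - (z s * sin t))
  by (apply is_derive_unique; auto_derive; [trivial | ring]).
assert (Ds : Derive (fun u => - (z s * sin u)) t = - (z s * cos t))
  by (apply is_derive_unique; auto_derive; [trivial | ring]).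
rewrite !Derive_const, Dc, Ds. reflexivity.
Qed.

(** Orthogonality to the parallels makes the normal radial in the last two coordinates,
    so it is the rotated image of a vector of R^3 orthogonal to position and
    velocity, that is of [e nu]. *)
Lemma principal_curvatures (I : R -> Prop) (hI : nondegenerate_interval I) (x y z : R -> R)
    (h : unit_speed_spherical_curve I x y z) (n : R4) (s t k1 k2 : R) :
  let c := curve_of I x y z h in
  I s -> z s <> 0 -> unit_normal (rot_param x y z) n s t ->
  principal_curvature (rot_param x y z) n s t (1, 0) k1 ->
  principal_curvature (rot_param x y z) n s t (0, 1) k2 ->
  exists e : R, e ^ 2 = 1 /\ k1 = e * curvature c s /\ k2 * z s = - e * nu3 c s.
Proof.
intros c Is z0 [nn [nX [nXs nXt]]] [_ [K1 _]] [_ [_ K2]].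
rewrite partial_ss_rot in K1.
rewrite partial_tt_rot in K2.
rewrite partial_t_rot in nXt, K2.
rewrite partial_s_rot in nXs, K1.
rewrite !Rmult_0_r, !Rmult_1_r, !Rplus_0_r in K1.
rewrite !Rmult_0_r, !Rmult_1_r, !Rplus_0_l in K2.
destruct n as [[[n1 n2] n3] n4].
unfold dot, rot_param, rotate in nn, nX, nXs, nXt, K1, K2. simpl in nn, nX, nXs, nXt, K1, K2.
set (m := n3 * cos t + n4 * sin t).
pose proof (cos_sin_sqr t) as cs.
assert (n34 : n4 * cos t = n3 * sin t).
{ apply (Rmult_eq_reg_l (z s)); [lra | assumption]. }
assert (E3 : n3 = m * cos t).
{ transitivity (n3 * (cos t ^ 2 + sin t ^ 2)); [rewrite cs; ring |].
  transitivity (n3 * cos t ^ 2 + sin t * (n3 * sin t)); [ring |].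
  rewrite <- n34. unfold m; ring. }
assert (E4 : n4 = m * sin t).
{ transitivity (n4 * (cos t ^ 2 + sin t ^ 2)); [rewrite cs; ring |].
  transitivity (n4 * sin t ^ 2 + cos t * (n4 * cos t)); [ring |].
  rewrite n34. unfold m; ring. }
clearbody m. subst n3 n4.
assert (nn' : n1 ^ 2 + n2 ^ 2 + m ^ 2 * (cos t ^ 2 + sin t ^ 2) = 1) by lra.
assert (nX' : cx c s * n1 + cy c s * n2 + cz c s * m * (cos t ^ 2 + sin t ^ 2) = 0) by (cbn; lra).
assert (nT' : dx c s * n1 + dy c s * n2 + dz c s * m * (cos t ^ 2 + sin t ^ 2) = 0) by (cbn; lra).
assert (K1' : ddx c s * n1 + ddy c s * n2 + ddz c s * m * (cos t ^ 2 + sin t ^ 2) =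
  k1 * (dx c s ^ 2 + dy c s ^ 2 + dz c s ^ 2 * (cos t ^ 2 + sin t ^ 2))) by (cbn; lra).
assert (K2' : - (z s * m) * (cos t ^ 2 + sin t ^ 2) =
  k2 * z s ^ 2 * (cos t ^ 2 + sin t ^ 2)) by lra.
rewrite cs, !Rmult_1_r in nn', nX', nT', K1', K2'.
rewrite (Rmult_1_r (dz c s ^ 2)), (unit_speed _ c s Is), Rmult_1_r in K1'.
clear nn nX nXs nXt K1 K2.
set (e := nu1 c s * n1 + nu2 c s * n2 + nu3 c s * m).
pose proof (frame_expansion (cx c s) (cy c s) (cz c s) (dx c s) (dy c s) (dz c s) n1 n2 m
  (on_sphere _ c s Is) (unit_speed _ c s Is) (pos_vel _ hI c s Is)) as F1.
pose proof (frame_expansion (cy c s) (cz c s) (cx c s) (dy c s) (dz c s) (dx c s) n2 m n1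
  (on_sphere _ (roll c) s Is) (unit_speed _ (roll c) s Is) (pos_vel _ hI (roll c) s Is)) as F2.
pose proof (frame_expansion (cz c s) (cx c s) (cy c s) (dz c s) (dx c s) (dy c s) m n1 n2
  (on_sphere _ (roll (roll c)) s Is) (unit_speed _ (roll (roll c)) s Is)
  (pos_vel _ hI (roll (roll c)) s Is)) as F3.
assert (N1 : n1 = e * nu1 c s).
{ rewrite <- F1 at 1. rewrite nX', nT'. unfold e, nu1, nu2, nu3; ring. }
assert (N2 : n2 = e * nu2 c s).
{ rewrite <- F2 at 1.
  replace (cy c s * n2 + cz c s * m + cx c s * n1) with 0 by lra.
  replace (dy c s * n2 + dz c s * m + dx c s * n1) with 0 by lra.
  unfold e, nu1, nu2, nu3; ring. }
assert (N3 : m = e * nu3 c s).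
{ rewrite <- F3 at 1.
  replace (cz c s * m + cx c s * n1 + cy c s * n2) with 0 by lra.
  replace (dz c s * m + dx c s * n1 + dy c s * n2) with 0 by lra.
  unfold e, nu1, nu2, nu3; ring. }
clear F1 F2 F3. clearbody e. exists e. repeat split.
- transitivity (e ^ 2 * (nu1 c s ^ 2 + nu2 c s ^ 2 + nu3 c s ^ 2));
    [rewrite (nu_unit hI c s Is); ring |].
  rewrite N1, N2, N3 in nn'. lra.
- rewrite <- K1', N1, N2, N3. unfold curvature; ring.
- apply (Rmult_eq_reg_l (z s)); [| assumption].
  transitivity (- (z s * m)); [lra | rewrite N3; ring].
Qed.

(** * Equations of the listed surfaces *)

(** Rotational surfaces on which a diagonal quadratic form in [x], [y], [z] vanishes; this
    is what both directions of the classification use of the conics, circles and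
    tori.  The quadratic form must be even in [z], so a moon is represented by the
    product of the equations of the great circle and of its mirror image. *)
Definition in_quadric (S : R4 -> Prop) (q1 q2 q3 : R) : Prop :=
  forall p, S p -> sphere3 p /\
    q1 * x1 p ^ 2 + q2 * x2 p ^ 2 + q3 * (x3 p ^ 2 + x4 p ^ 2) = 0.

Lemma param_in_quadric {I} (c : sphere_curve I) (S : R4 -> Prop) q1 q2 q3 :
  in_quadric S q1 q2 q3 -> (forall s t, I s -> S (param c s t)) ->
  forall s, I s -> q1 * cx c s ^ 2 + q2 * cy c s ^ 2 + q3 * cz c s ^ 2 = 0.
Proof.
intros hS inS s Is. destruct (hS _ (inS s 0 Is)) as [_ E]. simpl in E.
rewrite cos_0, sin_0 in E. lra.
Qed.

(** The gradient is [2 l nu], and it is nonzero because its third component is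
    [2 q3 z]. *)
Lemma open_part_conic {I} (hI : nondegenerate_interval I) (c : sphere_curve I)
    (S : R4 -> Prop) (q1 q2 q3 : R) :
  (forall s, I s -> cz c s <> 0) -> in_quadric S q1 q2 q3 -> q3 <> 0 ->
  (forall s t, I s -> S (param c s t)) -> is_open_part_of I (param c) S.
Proof.
intros hz hS q0 inS.
apply (open_part hI c S q1 q2 q3 0 0 hz); [| | exact inS].
- intros p Sp. destruct (hS p Sp). split; [assumption | lra].
- intros s Is E.
  destruct (conic_along_normal hI c q1 q2 q3 (param_in_quadric c S q1 q2 q3 hS inS) s Is)
    as [l [E1 [E2 E3]]].
  assert (l0 : l = 0).
  { transitivity (l * (nu1 c s ^ 2 + nu2 c s ^ 2 + nu3 c s ^ 2));
      [rewrite (nu_unit hI c s Is); ring |].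
    transitivity (q1 * cx c s * nu1 c s + q2 * cy c s * nu2 c s + q3 * cz c s * nu3 c s);
      [rewrite E1, E2, E3; ring | lra]. }
  rewrite l0, Rmult_0_l in E3. apply Rmult_integral in E3.
  destruct E3; [apply q0 | apply (hz s Is)]; assumption.
Qed.

(** At [d = 0] this is the equatorial sphere.  The plane [y = d] is transverse to the
    sphere along the curve since [y^2 + y'^2 + nu2^2 = 1], where [y' = 0] and
    [y^2 < 1]. *)
Lemma open_part_umbilical {I} (hI : nondegenerate_interval I) (c : sphere_curve I) (d : R) :
  (forall s, I s -> cz c s <> 0) -> d ^ 2 < 1 ->
  (forall s, I s -> cy c s = d) ->
  is_open_part_of I (param c) (fun p => sphere3 p /\ x2 p = d).
Proof.
intros hz d1 hy.
apply (open_part hI c _ 0 0 0 1 d hz).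
- intros p [sp E]. split; [assumption | lra].
- intros s Is E.
  assert (dy0 : dy c s = 0)
    by exact (derive_zero_of_constant I (cy c) d s _ hI hy Is (derive_cy _ c s Is)).
  pose proof (frame_expansion (cy c s) (cz c s) (cx c s) (dy c s) (dz c s) (dx c s) 1 0 0
    (on_sphere _ (roll c) s Is) (unit_speed _ (roll c) s Is) (pos_vel _ hI (roll c) s Is)) as F.
  change (cz c s * dx c s - cx c s * dz c s) with (nu2 c s) in F.
  rewrite (hy s Is), dy0 in F.
  replace (nu2 c s) with 0 in F by lra. lra.
- intros s t Is. split.
  + unfold sphere3, dot; simpl. pose proof (on_sphere _ c s Is) as sp.
    transitivity (cx c s ^ 2 + cy c s ^ 2 + cz c s ^ 2 * (cos t ^ 2 + sin t ^ 2)); [ring |].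
    rewrite cos_sin_sqr, Rmult_1_r; exact sp.
  + exact (hy s Is).
Qed.

Lemma sphere3_rotate (q : R3) (t : R) : sphere2 q -> sphere3 (rotate q t).
Proof.
destruct q as [[x y] z]; unfold sphere2, sphere3, dot; simpl; intros e.
transitivity (x ^ 2 + y ^ 2 + z ^ 2 * (cos t ^ 2 + sin t ^ 2)); [ring |].
rewrite cos_sin_sqr; lra.
Qed.

Lemma rotate_radius_sqr (q : R3) (t : R) : x3 (rotate q t) ^ 2 + x4 (rotate q t) ^ 2 = snd q ^ 2.
Proof.
destruct q as [[x y] z]; simpl.
transitivity (z ^ 2 * (cos t ^ 2 + sin t ^ 2)); [ring |]. rewrite cos_sin_sqr; ring.
Qed.

Lemma rot_surface_in_quadric (C : R3 -> Prop) q1 q2 q3 :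
  (forall x y z, C (x, y, z) -> x ^ 2 + y ^ 2 + z ^ 2 = 1 /\
     q1 * x ^ 2 + q2 * y ^ 2 + q3 * z ^ 2 = 0) ->
  in_quadric (rot_surface C) q1 q2 q3.
Proof.
intros hC p [[[x y] z] [t [Cq ->]]]. destruct (hC x y z Cq) as [sp E]. split.
- apply sphere3_rotate; exact sp.
- rewrite rotate_radius_sqr; exact E.
Qed.

Lemma conicV_in_quadric A B :
  in_quadric (rot_surface (conicV A B)) (1 / A ^ 2 - 1) (1 / B ^ 2 - 1) (- 1).
Proof.
apply rot_surface_in_quadric. intros x y z [sp E]. unfold sphere2 in sp. split; [lra |].
unfold Rdiv in *. lra.
Qed.

Lemma conicH_in_quadric C D :
  in_quadric (rot_surface (conicH C D)) (1 / C ^ 2 - 1) (- 1) (1 / D ^ 2 - 1).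
Proof.
apply rot_surface_in_quadric. intros x y z [sp E]. unfold sphere2 in sp. split; [lra |].
unfold Rdiv in *. lra.
Qed.

Lemma moon_in_quadric theta :
  in_quadric (rot_surface (moon_circle theta)) 0 (sin theta ^ 2) (- cos theta ^ 2).
Proof.
apply rot_surface_in_quadric. intros x y z [sp E]. unfold sphere2 in sp. split; [lra |].
transitivity ((sin theta * y) ^ 2 - (cos theta * z) ^ 2); [ring | rewrite E; ring].
Qed.

Lemma torus_in_quadric phi0 :
  in_quadric (standard_torus phi0) (- sin phi0 ^ 2) (- sin phi0 ^ 2) (cos phi0 ^ 2).
Proof.
intros p [sp E]. split; [assumption |]. rewrite E.
unfold sphere3, dot in sp.
transitivity (sin phi0 ^ 2 * (cos phi0 ^ 2 - (x1 p ^ 2 + x2 p ^ 2))); [ring |].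
pose proof (cos_sin_sqr phi0).
replace (x1 p ^ 2 + x2 p ^ 2) with (cos phi0 ^ 2) by lra. ring.
Qed.

Lemma umbilical_in_quadric delta :
  in_quadric (umbilical_sphere delta) (- tanh delta ^ 2) (1 - tanh delta ^ 2) (- tanh delta ^ 2).
Proof.
intros p [sp E]. split; [assumption |].
unfold sphere3, dot in sp. rewrite <- E.
transitivity (x2 p ^ 2 * (1 - (x1 p * x1 p + x2 p * x2 p + x3 p * x3 p + x4 p * x4 p)));
  [ring | rewrite sp; ring].
Qed.

(** * Recognising the surface *)

Lemma translation_translation a b p : translation a (translation b p) = translation (a + b) p.
Proof.
destruct p as [[[p1 p2] p3] p4]; unfold translation; simpl.
rewrite cos_plus, sin_plus. repeat apply (f_equal2 pair); ring.
Qed.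

(** The angle is half the polar angle of [((ga - al) / 2, be)], and the eigenvalues are
    the mean of [al] and [ga] plus and minus the length of that vector. *)
Lemma diagonalise (al be ga : R) : exists a a1 a2, a1 <= a2 /\ forall x y,
  a1 * (cos a * x - sin a * y) ^ 2 + a2 * (sin a * x + cos a * y) ^ 2 =
  al * x ^ 2 + 2 * be * x * y + ga * y ^ 2.
Proof.
set (r := sqrt (((ga - al) / 2) ^ 2 + be ^ 2)).
assert (r2 : r ^ 2 = ((ga - al) / 2) ^ 2 + be ^ 2).
{ apply pow2_sqrt. pose proof (pow2_ge_0 ((ga - al) / 2)). pose proof (pow2_ge_0 be). lra. }
assert (r0 : 0 <= r) by apply sqrt_pos.
assert (T : exists t, (ga - al) / 2 = r * cos t /\ be = r * sin t).
{ destruct (Req_dec r 0) as [rz | rz].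
  - exists 0. rewrite rz in *.
    pose proof (pow2_ge_0 ((ga - al) / 2)). pose proof (pow2_ge_0 be).
    split; rewrite Rmult_0_l; apply Rsqr_0_uniq; rewrite Rsqr_pow2; lra.
  - apply polar_coordinates; [assumption | symmetry; exact r2]. }
destruct T as [t [Ec Es]].
exists (t / 2), ((al + ga) / 2 - r), ((al + ga) / 2 + r). split; [lra |]. intros x y.
replace t with (2 * (t / 2)) in Ec, Es by field.
rewrite cos_2a in Ec. rewrite sin_2a in Es.
set (C := cos (t / 2)) in *. set (S := sin (t / 2)) in *.
assert (CS : C ^ 2 + S ^ 2 = 1) by apply cos_sin_sqr.
transitivity ((al + ga) / 2 * (C ^ 2 + S ^ 2) * (x ^ 2 + y ^ 2) +
  (r * (C * C - S * S)) * (y ^ 2 - x ^ 2) + 2 * (r * (2 * S * C)) * x * y); [field |].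
rewrite <- Ec, <- Es, CS. field.
Qed.

Definition listed (I : R -> Prop) (X : R -> R -> R4) : Prop :=
  let part := is_open_part_of I X in
  part equatorial_sphere \/
  (exists delta : R, 0 <= delta /\ part (umbilical_sphere delta)) \/
  (exists phi0 : R, 0 < phi0 < PI / 2 /\ part (standard_torus phi0)) \/
  (exists theta : R, 0 < theta < PI /\ theta <> PI / 2 /\
     part (rot_surface (moon_circle theta))) \/
  (exists Q : R4 -> Prop, nondegenerate_quadric Q /\ part Q).

Definition listed_up_to_translation {I} (c : sphere_curve I) : Prop :=
  exists a, listed I (param (turn a c)).

Lemma listed_turn {I} a (c : sphere_curve I) :
  listed_up_to_translation (turn a c) -> listed_up_to_translation c.
Proof.
intros [b hb]. exists (b + a).
replace (param (turn (b + a) c)) with (param (turn b (turn a c))); [exact hb |].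
apply functional_extensionality; intros s; apply functional_extensionality; intros t.
exact (translation_translation b a (param c s t)).
Qed.

Lemma listed_here {I} (c : sphere_curve I) :
  listed I (param c) -> listed_up_to_translation c.
Proof.
intros h. exists 0. replace (param (turn 0 c)) with (param c); [exact h |].
apply functional_extensionality; intros s; apply functional_extensionality; intros t.
unfold param, turn, rot_param; simpl. rewrite cos_0, sin_0.
repeat apply (f_equal2 pair); ring.
Qed.

Lemma angle_of_slope (w : R) : 0 < w ->
  exists phi, 0 < phi < PI / 2 /\ sin phi = w * cos phi /\ 0 < cos phi.
Proof.
intros w0. exists (atan w).
pose proof (atan_bound w) as B. pose proof (tan_atan w) as T.
assert (c0 : 0 < cos (atan w)) by (apply cos_gt_0; lra).
assert (a0 : 0 < atan w) by (rewrite <- atan_0; apply atan_increasing; assumption).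
split; [lra | split; [| assumption]].
rewrite <- T at 2. unfold tan. field. lra.
Qed.

Lemma square_root (w : R) : 0 < w ->
  exists r, 0 < r /\ r ^ 2 = w /\ (w < 1 -> r < 1) /\ (1 < w -> 1 < r).
Proof.
intros w0. exists (sqrt w).
assert (r0 : 0 < sqrt w) by (apply sqrt_lt_R0; assumption).
assert (r2 : sqrt w ^ 2 = w) by (apply pow2_sqrt; lra).
repeat split; try assumption; intros h; nra.
Qed.

(** [delta = artanh d]. *)
Lemma tanh_surjective (d : R) : 0 < d < 1 -> exists delta, 0 <= delta /\ tanh delta = d.
Proof.
intros hd. set (q := (1 + d) / (1 - d)).
assert (q1 : 1 < q) by (apply (Rmult_lt_reg_r (1 - d)); [lra | unfold q; field_simplify; lra]).
exists (ln q / 2).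
assert (l0 : 0 < ln q) by (rewrite <- ln_1; apply ln_increasing; lra).
split; [lra |].
set (e := exp (ln q / 2)).
assert (e0 : 0 < e) by apply exp_pos.
assert (e2 : e * e = q).
{ unfold e. rewrite <- exp_plus. replace (ln q / 2 + ln q / 2) with (ln q) by field.
  apply exp_ln; lra. }
unfold tanh, sinh, cosh. rewrite exp_Ropp. fold e.
assert (0 < e * e) by nra.
transitivity ((e * e - 1) / (e * e + 1)); [field; repeat split; nra |].
rewrite e2. unfold q. field. lra.
Qed.

(** Since [z] has no zero, [a2 > 0].  Adding multiples of the equation of the sphere turns
    [a1 x^2 + a2 y^2 = z^2] into [(1 + a1) x^2 + (1 + a2) y^2 = 1] or into
    [(a2 - a1) x^2 + (1 + a2) z^2 = a2]; the first is a conic [conicV] when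
    [a1 > -1], the second a conic [conicH].  In order: [0 < a1 < a2] is the
    one-piece hyperboloid, [0 < a1 = a2] the torus, [a1 = 0] the moon,
    [a1 < -1] the oblate ellipsoid, [a1 = -1] a pair of small circles, and
    [-1 < a1 < 0] the two-piece hyperboloid.  The prolate ellipsoid is the last one with
    [x] and [y] exchanged, so it needs no case of its own. *)
Lemma listed_of_diagonal_conic {I} (hI : nondegenerate_interval I) (c : sphere_curve I) a1 a2 :
  (forall s, I s -> cz c s <> 0) -> a1 <= a2 ->
  (forall s, I s -> a1 * cx c s ^ 2 + a2 * cy c s ^ 2 = cz c s ^ 2) ->
  listed_up_to_translation c.
Proof.
intros hz a12 hq.
assert (a2pos : 0 < a2).
{ destruct (proj2 hI) as [s [_ [Is _]]]. pose proof (hq s Is).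
  assert (0 < cz c s ^ 2) by (apply pow2_gt_0, hz, Is).
  pose proof (pow2_ge_0 (cx c s)). pose proof (pow2_ge_0 (cy c s)). nra. }
assert (mem : forall C : R3 -> Prop, (forall s, I s -> C (cx c s, cy c s, cz c s)) ->
  forall s t, I s -> rot_surface C (param c s t)).
{ intros C hC s t Is. exists (cx c s, cy c s, cz c s), t. split; [exact (hC s Is) | reflexivity]. }
destruct (Rtotal_order 0 a1) as [a1pos | [<- | a1neg]];
  [destruct (Rle_lt_or_eq_dec _ _ a12) as [lt12 | <-] | |
   destruct (Rtotal_order a1 (-1)) as [a1lt | [-> | a1gt]]].
- apply listed_here; do 4 right.
  destruct (square_root (a2 / (a2 - a1))) as [C [C0 [C2 [_ C1]]]];
    [apply Rdiv_lt_0_compat; lra |].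
  destruct (square_root (a2 / (1 + a2))) as [D [D0 [D2 [D1 _]]]];
    [apply Rdiv_lt_0_compat; lra |].
  specialize (C1 ltac:(apply Rlt_div_r; lra)).
  specialize (D1 ltac:(apply Rlt_div_l; lra)).
  exists (rot_surface (conicH C D)). split; [constructor; assumption |].
  apply (open_part_conic hI c _ _ _ _ hz (conicH_in_quadric C D)).
  + rewrite D2. replace (1 / (a2 / (1 + a2)) - 1) with (1 / a2) by (field; lra).
    apply Rgt_not_eq, Rdiv_lt_0_compat; lra.
  + apply mem. intros s Is. split; [exact (on_sphere _ c s Is) |].
    rewrite C2, D2. pose proof (on_sphere _ c s Is). pose proof (hq s Is).
    transitivity (((a2 - a1) * cx c s ^ 2 + (1 + a2) * cz c s ^ 2) / a2); [field; lra |].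
    replace ((a2 - a1) * cx c s ^ 2 + (1 + a2) * cz c s ^ 2) with
      (a2 * (cx c s ^ 2 + cy c s ^ 2 + cz c s ^ 2)) by lra.
    rewrite (on_sphere _ c s Is). field; lra.
- apply listed_here; do 2 right; left.
  destruct (square_root a1 a1pos) as [w [w0 [w2 _]]].
  destruct (angle_of_slope w w0) as [phi [hphi [sc c0]]].
  exists phi. split; [exact hphi |].
  apply (open_part_conic hI c _ _ _ _ hz (torus_in_quadric phi));
    [apply pow_nonzero; lra |].
  intros s t Is. split; [apply sphere3_rotate, (on_sphere _ c s Is) |].
  unfold param, rot_param. rewrite rotate_radius_sqr; simpl snd.
  pose proof (cos_sin_sqr phi) as cs. rewrite sc in cs |- *.
  pose proof (on_sphere _ c s Is). pose proof (hq s Is).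
  rewrite Rpow_mult_distr, w2 in cs |- *.
  apply (Rmult_eq_reg_l (1 + a1)); [| lra].
  transitivity (a1 * (cx c s ^ 2 + cy c s ^ 2 + cz c s ^ 2)); [lra |].
  rewrite (on_sphere _ c s Is). transitivity (a1 * (cos phi ^ 2 + a1 * cos phi ^ 2));
    [rewrite cs; reflexivity | ring].
- apply listed_here; do 3 right; left.
  destruct (square_root a2 a2pos) as [w [w0 [w2 _]]].
  destruct (angle_of_slope w w0) as [phi [hphi [sc c0]]].
  exists phi. split; [lra | split; [lra |]].
  apply (open_part_conic hI c _ _ _ _ hz (moon_in_quadric phi));
    [pose proof (pow_lt _ 2 c0); lra |].
  intros s t Is. pose proof (hq s Is) as E.
  assert (F : (w * cy c s - cz c s) * (w * cy c s + cz c s) = 0).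
  { transitivity (w ^ 2 * cy c s ^ 2 - cz c s ^ 2); [ring | rewrite w2; lra]. }
  apply Rmult_integral in F. destruct F as [F | F].
  + exists (cx c s, cy c s, cz c s), t. split; [split |reflexivity].
    * exact (on_sphere _ c s Is).
    * rewrite sc. replace (cz c s) with (w * cy c s) by lra. ring.
  + (* The mirror image of the great circle in [z = 0] sweeps out the same surface. *)
    exists (cx c s, cy c s, - cz c s), (t + PI). split; [split |].
    * pose proof (on_sphere _ c s Is). simpl; lra.
    * rewrite sc. replace (cz c s) with (- (w * cy c s)) by lra. ring.
    * unfold param, rot_param, rotate. rewrite neg_cos, neg_sin.
      repeat apply (f_equal2 pair); ring.
- (* The quarter turn exchanges the roles of [x] and [y], hence of [a1] and [a2],
     in the form of [conicH]. *)
  apply (listed_turn (PI / 2)), listed_here; do 4 right.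
  destruct (square_root (a1 / (a1 - a2))) as [C [C0 [C2 [C1 _]]]].
  { replace (a1 / (a1 - a2)) with ((- a1) / (a2 - a1)) by (field; lra).
    apply Rdiv_lt_0_compat; lra. }
  destruct (square_root (a1 / (1 + a1))) as [D [D0 [D2 [_ D1]]]].
  { replace (a1 / (1 + a1)) with ((- a1) / (- a1 - 1)) by (field; lra).
    apply Rdiv_lt_0_compat; lra. }
  replace (a1 / (a1 - a2)) with ((- a1) / (a2 - a1)) in C1 by (field; lra).
  replace (a1 / (1 + a1)) with ((- a1) / (- a1 - 1)) in D1 by (field; lra).
  specialize (C1 ltac:(apply Rlt_div_l; lra)).
  specialize (D1 ltac:(apply Rlt_div_r; lra)).
  exists (rot_surface (conicH C D)). split; [apply oblate_ellipsoid; assumption |].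
  apply (open_part_conic hI (turn (PI / 2) c) _ _ _ _ hz (conicH_in_quadric C D)).
  + rewrite D2. replace (1 / (a1 / (1 + a1)) - 1) with (1 / a1) by (field; lra).
    apply Rlt_not_eq. unfold Rdiv; rewrite Rmult_1_l. apply Rinv_lt_0_compat; lra.
  + intros s t Is.
    exists (cx (turn (PI / 2) c) s, cy (turn (PI / 2) c) s, cz c s), t.
    split; [split; [exact (on_sphere _ (turn (PI / 2) c) s Is) |] | reflexivity].
    simpl cx; simpl cy. rewrite cos_PI2, sin_PI2, C2, D2.
    pose proof (on_sphere _ c s Is). pose proof (hq s Is).
    transitivity (((a1 - a2) * cy c s ^ 2 + (1 + a1) * cz c s ^ 2) / a1); [field; lra |].
    replace ((a1 - a2) * cy c s ^ 2 + (1 + a1) * cz c s ^ 2) with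
      (a1 * (cx c s ^ 2 + cy c s ^ 2 + cz c s ^ 2)) by lra.
    rewrite (on_sphere _ c s Is). field; lra.
- destruct (square_root (1 / (1 + a2))) as [d [d0 [d2 [d1 _]]]];
    [apply Rdiv_lt_0_compat; lra |].
  specialize (d1 ltac:(apply Rlt_div_l; lra)).
  destruct (tanh_surjective d (conj d0 d1)) as [delta [delta0 hd]].
  assert (ysqr : forall s, I s -> cy c s ^ 2 = d ^ 2).
  { intros s Is. rewrite d2. pose proof (on_sphere _ c s Is). pose proof (hq s Is).
    apply (Rmult_eq_reg_l (1 + a2)); [field_simplify; lra | lra]. }
  (* The equation determines [y] up to sign; its derivative vanishes, so the curve
     stays on one of the two circles. *)
  assert (dy0 : forall s, I s -> dy c s = 0).
  { intros s Is.
    assert (E : 2 * cy c s * dy c s = 0).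
    { apply (derive_zero_of_constant I (fun u => cy c u ^ 2) (d ^ 2) s _ hI ysqr Is).
      derive_curve. ring. }
    apply Rmult_integral in E. destruct E as [E | E]; [| assumption].
    pose proof (ysqr s Is). nra. }
  destruct (proj2 hI) as [a [_ [Ia _]]].
  assert (const : forall s, I s -> cy c s = cy c a).
  { intros s Is. apply (constant_of_derive_zero I (cy c) s a hI); [| assumption ..].
    intros u Iu. rewrite <- (dy0 u Iu). apply derive_cy, Iu. }
  assert (dlt : d ^ 2 < 1) by nra.
  assert (F : (cy c a - d) * (cy c a + d) = 0)
    by (pose proof (ysqr a Ia); lra).
  apply Rmult_integral in F. destruct F as [F | F].
  + apply listed_here; right; left. exists delta. split; [exact delta0 |].
    unfold umbilical_sphere; rewrite hd.
    apply open_part_umbilical; try assumption.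
    intros s Is. rewrite (const s Is). lra.
  + apply (listed_turn PI), listed_here; right; left. exists delta. split; [exact delta0 |].
    unfold umbilical_sphere; rewrite hd.
    apply open_part_umbilical; try assumption.
    intros s Is. simpl. rewrite cos_PI, sin_PI, (const s Is). lra.
- apply listed_here; do 4 right.
  destruct (square_root (1 / (1 + a1))) as [A [A0 [A2 [_ A1]]]];
    [apply Rdiv_lt_0_compat; lra |].
  destruct (square_root (1 / (1 + a2))) as [B [B0 [B2 [B1 _]]]];
    [apply Rdiv_lt_0_compat; lra |].
  specialize (A1 ltac:(apply Rlt_div_r; lra)).
  specialize (B1 ltac:(apply Rlt_div_l; lra)).
  exists (rot_surface (conicV A B)). split; [apply two_piece_hyperboloid; assumption |].
  apply (open_part_conic hI c _ _ _ _ hz (conicV_in_quadric A B)); [lra |].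
  apply mem. intros s Is. split; [exact (on_sphere _ c s Is) |].
  rewrite A2, B2. pose proof (on_sphere _ c s Is). pose proof (hq s Is).
  transitivity ((1 + a1) * cx c s ^ 2 + (1 + a2) * cy c s ^ 2); [field; lra | lra].
Qed.

Lemma listed_of_cubic {I} (hI : nondegenerate_interval I) (c : sphere_curve I) m :
  (forall s, I s -> cz c s <> 0) -> cubic c m -> listed_up_to_translation c.
Proof.
intros hz hm.
destruct (nu3_zero_or_nonzero hI c m hz hm) as [n0 | n0].
- destruct (meridian_of_nu3_zero hI c m hz hm n0) as [n1 [n2 [n12 hn]]].
  destruct (polar_angle n2 n1) as [a [-> ->]]; [lra |].
  apply (listed_turn a), listed_here; left.
  apply open_part_umbilical; [assumption .. | lra | exact hn].
- destruct (conic_of_cubic hI c m hz hm n0) as [al [be [ga hq]]].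
  destruct (diagonalise al be ga) as [a [a1 [a2 [a12 hd]]]].
  apply (listed_turn a), (listed_of_diagonal_conic hI (turn a c) a1 a2 hz a12).
  intros s Is. exact (eq_trans (hd (cx c s) (cy c s)) (hq s Is)).
Qed.

(** * From the surfaces back to the cubic relation *)

Lemma cubic_of_quadric {I} (hI : nondegenerate_interval I) (c : sphere_curve I)
    (S : R4 -> Prop) q1 q2 q3 :
  (forall s, I s -> cz c s <> 0) -> in_quadric S q1 q2 q3 -> q3 <> 0 ->
  is_open_part_of I (param c) S -> exists m, cubic c m.
Proof.
intros hz hS q0 [inS _]. exists (q1 * q2 / q3 ^ 2).
apply cubic_of_conic; try assumption. exact (param_in_quadric c S q1 q2 q3 hS inS).
Qed.

Lemma cubic_of_equatorial {I} (hI : nondegenerate_interval I) (c : sphere_curve I) :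
  (forall s, I s -> cy c s = 0) -> cubic c 0.
Proof.
intros hy s Is.
assert (dy0 : forall u, I u -> dy c u = 0)
  by (intros u Iu; exact (derive_zero_of_constant I (cy c) 0 u _ hI hy Iu (derive_cy _ c u Iu))).
assert (ddy0 : ddy c s = 0)
  by exact (derive_zero_of_constant I (dy c) 0 s _ hI dy0 Is (derive_dy _ c s Is)).
unfold curvature, nu1, nu3. rewrite (hy s Is), (dy0 s Is), ddy0. ring.
Qed.

Lemma tanh_pos delta : 0 < delta -> 0 < tanh delta.
Proof.
intros d0. unfold tanh. apply Rdiv_lt_0_compat.
- rewrite <- sinh_0. apply sinh_lt; assumption.
- unfold cosh. pose proof (exp_pos delta). pose proof (exp_pos (- delta)). lra.
Qed.

Lemma inv_sqr_ne_1 D : 0 < D -> D <> 1 -> 1 / D ^ 2 - 1 <> 0.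
Proof.
intros D0 D1 E. apply D1.
assert (D ^ 2 = 1).
{ assert (1 / D ^ 2 = 1) by lra. replace 1 with (1 / D ^ 2 * D ^ 2) by (field; lra).
  rewrite H. ring. }
nra.
Qed.

Lemma cubic_of_listed {I} (hI : nondegenerate_interval I) (c : sphere_curve I) :
  (forall s, I s -> cz c s <> 0) -> listed_up_to_translation c -> exists m, cubic c m.
Proof.
intros hz [a L].
assert (T : exists m, cubic (turn a c) m).
{ pose proof (fun S q1 q2 q3 => cubic_of_quadric hI (turn a c) S q1 q2 q3 hz) as quadric.
  destruct L as [E | [[delta [d0 E]] | [[phi [hphi E]] | [[theta [ht [ht' E]]] | [Q [hQ E]]]]]].
  - exists 0. apply (cubic_of_equatorial hI).
    intros s Is. exact (proj2 (proj1 E s 0 Is)).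
  - destruct d0 as [d0 | <-].
    + apply (quadric _ _ _ _ (umbilical_in_quadric delta)); [| exact E].
      pose proof (pow_lt _ 2 (tanh_pos delta d0)); lra.
    + exists 0. apply (cubic_of_equatorial hI). intros s Is.
      rewrite (proj2 (proj1 E s 0 Is) : cy (turn a c) s = tanh 0).
      unfold tanh. rewrite sinh_0. unfold Rdiv; ring.
  - apply (quadric _ _ _ _ (torus_in_quadric phi)); [| exact E].
    apply pow_nonzero, Rgt_not_eq, cos_gt_0; lra.
  - apply (quadric _ _ _ _ (moon_in_quadric theta)); [| exact E].
    assert (c0 : cos theta <> 0).
    { destruct (Rtotal_order theta (PI / 2)) as [h | [h | h]]; [| contradiction |].
      - apply Rgt_not_eq, cos_gt_0; lra.
      - apply Rlt_not_eq, cos_lt_0; lra. }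
    pose proof (pow2_gt_0 _ c0); lra.
  - destruct hQ as [C D ? ? ? | A B ? ? ? | A B ? ? ? | C D ? ? ?].
    + apply (quadric _ _ _ _ (conicH_in_quadric C D)); [apply inv_sqr_ne_1; lra | exact E].
    + apply (quadric _ _ _ _ (conicV_in_quadric A B)); [lra | exact E].
    + apply (quadric _ _ _ _ (conicV_in_quadric A B)); [lra | exact E].
    + apply (quadric _ _ _ _ (conicH_in_quadric C D)); [apply inv_sqr_ne_1; lra | exact E]. }
destruct T as [m hm]. exists m. intros s Is.
rewrite <- (curvature_turn a), <- (nu3_turn a). exact (hm s Is).
Qed.

Theorem theorem6p1 (I : R -> Prop) (x y z : R -> R)
    (N : R -> R -> R4) (km kp : R -> R -> R)
    (hI : nondegenerate_interval I)
    (hxi : unit_speed_spherical_curve I x y z)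
    (hz : forall s, I s -> z s <> 0)
    (hN : forall s t, I s -> unit_normal (rot_param x y z) (N s t) s t)
    (hkm : forall s t, I s ->
       principal_curvature (rot_param x y z) (N s t) s t (1, 0) (km s t))
    (hkp : forall s t, I s ->
       principal_curvature (rot_param x y z) (N s t) s t (0, 1) (kp s t)) :
  (exists mu : R, forall s t, I s -> km s t = mu * kp s t ^ 3)
  <->
  (exists a : R,
     let part := is_open_part_of I (fun s t => translation a (rot_param x y z s t)) in
     part equatorial_sphere \/
     (exists delta : R, 0 <= delta /\ part (umbilical_sphere delta)) \/
     (exists phi0 : R, 0 < phi0 < PI / 2 /\ part (standard_torus phi0)) \/
     (exists theta : R, 0 < theta < PI /\ theta <> PI / 2 /\
        part (rot_surface (moon_circle theta))) \/
     (exists Q : R4 -> Prop, nondegenerate_quadric Q /\ part Q)).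
Proof.
set (c := curve_of I x y z hxi).
assert (K : forall s t, I s -> exists e : R,
  e ^ 2 = 1 /\ km s t = e * curvature c s /\ kp s t * z s = - e * nu3 c s).
{ intros s t Is. apply (principal_curvatures I hI x y z hxi (N s t) s t); auto. }
split.
- intros [mu hmu]. apply (listed_of_cubic hI c (- mu) hz). intros s Is.
  destruct (K s 0 Is) as [e [e2 [Em Ep]]]. specialize (hmu s 0 Is).
  transitivity (e ^ 2 * (curvature c s * z s ^ 3));
    [rewrite e2; change (cz c s) with (z s); ring |].
  transitivity (e * z s ^ 3 * (e * curvature c s)); [ring |].
  rewrite <- Em, hmu.
  transitivity (e * mu * (kp s 0 * z s) ^ 3); [ring |].
  rewrite Ep. transitivity (- mu * nu3 c s ^ 3 * (e ^ 2) ^ 2); [ring | rewrite e2; ring].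
- intros L. destruct (cubic_of_listed hI c hz L) as [m hm].
  exists (- m). intros s t Is. pose proof (hz s Is) as z0.
  destruct (K s t Is) as [e [e2 [Em Ep]]].
  apply (Rmult_eq_reg_r (z s ^ 3)); [| apply pow_nonzero; assumption].
  transitivity (e * (curvature c s * cz c s ^ 3)); [rewrite Em; change (cz c s) with (z s); ring |].
  rewrite (hm s Is).
  transitivity (- m * (kp s t * z s) ^ 3); [| ring].
  rewrite Ep. transitivity (m * nu3 c s ^ 3 * e * 1); [ring | rewrite <- e2; ring].
Qed.
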